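(* Let $q,a,b,k,y,z$ be nonzero complex numbers with $|q|<1$, such that no zero factor occurs in any denominator below (including the denominators of the terms of the series) and all the series below converge absolutely. Then $$\frac{(qab/k,kq/b;q)_\infty\,(q,k^2q/a,q^2a,q^2a^2/k^2;q^2)_\infty}{(kq,qa/k;q)_\infty}\;{}_{10}W_{9}\left(k;\frac{k^2}{ab},b,\sqrt{qa},-\sqrt{qa},\frac{ky}{a},\frac{kz}{a},\frac{aq}{yz};\,q,\,-\frac{qa}{k}\right)$$ $$=\left(\frac{k^2q}{ab},bq,\frac{a^2bq^2}{k^2},\frac{q^2a}{b};q^2\right)_\infty {}_{12}W_{11}\left(a;\frac{k^2}{ab},b,aq,y,yq,z,zq,\frac{a^2q}{kyz},\frac{a^2q^2}{kyz};\,q^2,\,q^2\right)$$ $$-q\,\frac{(1-aq^2)(1-y)(1-z)(1-a^2q/kyz)}{(1-q)(1-aq/y)(1-aq/z)(1-kyz/a)}\left(\frac{k^2}{ab},b,\frac{a^2bq^3}{k^2},\frac{q^3a}{b};q^2\right)_\infty$$ $$\times\;{}_{12}W_{11}\left(q^2a;\frac{k^2q}{ab},bq,aq,yq,yq^2,zq,zq^2,\frac{a^2q^2}{kyz},\frac{a^2q^3}{kyz};\,q^2,\,q^2\right).$$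
   Context: Notation: $(x;q)_0=1$, $(x;q)_n=\prod_{j=0}^{n-1}(1-xq^j)$, $(x;q)_\infty=\prod_{j\ge 0}(1-xq^j)$, and $(x_1,\dots,x_m;q)_n=(x_1;q)_n\cdots(x_m;q)_n$ for $n$ a nonnegative integer or $\infty$. In expressions such as $k^2/ab$ or $a^2q/kyz$ the whole product after the slash is the denominator. The very-well-poised series with base $p$ (here $p=q$ or $p=q^2$) is $${}_{r+1}W_{r}(a_1;a_4,\dots,a_{r+1};p,x)=\sum_{n=0}^{\infty}\frac{(a_1,p\sqrt{a_1},-p\sqrt{a_1},a_4,\dots,a_{r+1};p)_n}{(p,\sqrt{a_1},-\sqrt{a_1},\frac{a_1p}{a_4},\dots,\frac{a_1p}{a_{r+1}};p)_n}\,x^n .$$ Square roots denote fixed choices of complex square root; each occurs together with its negative, so the choice is immaterial. *)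

(* Defs.v *)
From HB Require Import structures.
From mathcomp Require Import all_boot all_order all_algebra.
From mathcomp Require Import all_classical all_reals all_analysis.

Set Implicit Arguments.
Unset Strict Implicit.
Unset Printing Implicit Defensive.

Import Order.TTheory GRing.Theory Num.Theory.
Import numFieldNormedType.Exports.

Local Open Scope ring_scope.
Local Open Scope classical_set_scope.

(* C carries the topology of its norm; for C = R[i] with R : realType this is
   the usual complex plane.  Notation: qpoch x q n is (x; q)_n, qpochs xs q n
   is (x_1, ..., x_m; q)_n, and the suffix _oo stands for n = oo. *)

Definition qpoch (C : numClosedFieldType) (x q : C) (n : nat) : C :=
  \prod_(j < n) (1 - x * q ^+ j).

Definition qpochs (C : numClosedFieldType) (xs : seq C) (q : C) (n : nat) : C :=
  \prod_(x <- xs) qpoch x q n.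

(* The limit exists when `|q| < 1 and C is complete *)
Definition qpoch_oo (C : numClosedFieldType) (x q : C) : C := limn (qpoch x q).

Definition qpochs_oo (C : numClosedFieldType) (xs : seq C) (q : C) : C :=
  \prod_(x <- xs) qpoch_oo x q.

Definition nonzero_factors (C : numClosedFieldType) (ds : seq C) (q : C) : Prop :=
  forall d, d \in ds -> forall j : nat, 1 - d * q ^+ j != 0.

(* In the series {r+1}W_r(a1; a4, ..., a_{r+1}; p, x) the parameters
   a4, ..., a_{r+1} are given as a sequence s, of size r - 2.  The branch of
   the square root is irrelevant, as each root occurs with its opposite. *)
Definition vwp_num (C : numClosedFieldType) (p a1 : C) (s : seq C) : seq C :=
  [:: a1, p * sqrtC a1, - (p * sqrtC a1) & s].

Definition vwp_den (C : numClosedFieldType) (p a1 : C) (s : seq C) : seq C :=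
  [:: p, sqrtC a1, - sqrtC a1 & [seq a1 * p / c | c <- s]].

Definition vwp_term (C : numClosedFieldType) (p a1 : C) (s : seq C) (x : C)
    (n : nat) : C :=
  qpochs (vwp_num p a1 s) p n / qpochs (vwp_den p a1 s) p n * x ^+ n.

Definition vwp_abs_cvg (C : numClosedFieldType) (p a1 : C) (s : seq C)
    (x : C) : Prop :=
  cvgn [normed series (vwp_term p a1 s x)].

Definition vwpW (C : numClosedFieldType) (p a1 : C) (s : seq C) (x : C) : C :=
  limn (series (vwp_term p a1 s x)).

(* Main.v *)
Require Import Defs.
From HB Require Import structures.
From mathcomp Require Import all_boot all_order all_algebra.
From mathcomp Require Import all_classical all_reals all_analysis.
From mathcomp Require Import complex ring lra.

Import Order.TTheory GRing.Theory Num.Theory.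
Import numFieldNormedType.Exports.
Import ComplexField.Normc.

Local Open Scope ring_scope.
Local Open Scope complex_scope.
Local Open Scope classical_set_scope.

(** Put [c = a/k], [b' = k^2/(ab)] and [w = a^2 q/(kyz)].  The series of base
    [q^2] on the right are the even and the odd part of one series of base [q]:
    up to the factor [1 - a], the right-hand side is the sum over [N] of
    [alpha_summand], whose general term contains
    [(a, y, z, w; q)_N / (q, aq/y, aq/z, aq/w; q)_N] and depends on the parity
    of [N] only through the quotients [(b; q)_oo / (b q^N; q^2)_oo]
    ([vwp_term_alpha_even], [vwp_term_alpha_odd]).

    Jackson's terminating sum ([jackson_sum]) writes the displayed ratio as a
    sum over [n <= N] of [wp_beta n], which carries the parameters of the
    series on the left, times a kernel that no longer involves [y] and [z].
    Exchanging the two summations leaves, for each [n], a series over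
    [r = N - n] that is summable in closed form ([mixed_sum_closed]); the
    closed form turns [wp_beta n] into the [n]-th term of the series on the
    left ([wp_bailey_transform], [vwp_term_beta]).

    Expanding the right-hand side rather than the left one is essential: the
    inner summands are then of the order of [q^r], and the double series is
    dominated by the absolute values of the left-hand terms times [|q|^r]
    ([pair_summand_le]).  So the absolute convergence of the left-hand series
    justifies the exchange, including the cases where [|qa/k| >= 1] and that
    series converges only because it terminates.

    The sum in closed form is the case of Bailey's nonterminating extension of
    Jackson's sum, in base [q^2], in which two pairs of parameters differ by a
    factor [q].  Multiplied by suitable infinite products it becomes a function
    [mixed_sum c b b'] without poles, and a telescoping argument with step 2
    relates its values at [c] and [c q] ([mixed_sum_step]).  Iterating, [c]
    tends to 0 and only a simpler series in [b] and [b'] remains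
    ([mixed_sum_closed0]); the same method sends [b] and [b'] to 0
    ([mixed_sum0_reduce]).  The last constant is read off at
    [c = 1], [b = b' = 0], where the series has a single nonzero term
    ([mixed_sum00]). *)

(** * Sequences and series of complex numbers *)

(** The topology of [R[i]] is that of its structure of numeric field.  Recording
    it on [R[i]] itself lets limits of sequences in [R[i]] be stated directly. *)
HB.instance Definition _ (R : rcfType) :=
  NormedModule.copy R[i] (R[i] : numClosedFieldType)^o.

Section ComplexSequences.
Context {R : realType}.
Implicit Types (x y l : R[i]) (u v : nat -> R[i]).

Lemma normcE_real x : `|x| = (normc x)%:C.
Proof. by case: x. Qed.

Lemma normc_ge0 x : 0 <= normc x.
Proof. by rewrite -ler0c -normcE_real. Qed.

Lemma ler_normcD x y : normc (x + y) <= normc x + normc y.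
Proof. exact: le_normcD. Qed.

Lemma normcM_le x y (a b : R) : normc x <= a -> normc y <= b -> normc (x * y) <= a * b.
Proof. by move=> xa yb; rewrite normcM ler_pM ?normc_ge0. Qed.

Lemma normcX x n : normc (x ^+ n) = normc x ^+ n.
Proof. by elim: n => [|n IH]; rewrite ?expr0 ?normc1 // !exprS normcM IH. Qed.

Lemma ler_normc_sum (u : nat -> R[i]) m n :
  normc (\sum_(m <= i < n) u i) <= \sum_(m <= i < n) normc (u i).
Proof.
elim/big_ind2: _ => [|x1 y1 x2 y2 h1 h2|//]; first by rewrite normc0.
by rewrite (le_trans (ler_normcD _ _))// lerD.
Qed.

Lemma normc_distC x y : normc (x - y) = normc (y - x).
Proof. by rewrite -normcN opprB. Qed.

Lemma cvg_normcP u l :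
  u @ \oo --> l <-> (fun n => normc (u n - l)) @ \oo --> (0 : R).
Proof.
split=> /cvgrPdist_lt h; apply/cvgrPdist_lt => e e0.
  have e0' : 0 < e%:C :> R[i] by rewrite ltcR.
  apply: filterS (h _ e0') => n; rewrite normcE_real ltcR sub0r normrN.
  by rewrite ger0_norm ?normc_ge0// normc_distC.
move: (e0); rewrite ltcE /= => /andP[/eqP eI eR].
have eE : e = (complex.Re e)%:C by case: e eI {e0 eR} => a b /= ->.
apply: filterS (h _ eR) => n; rewrite sub0r normrN ger0_norm ?normc_ge0//.
by rewrite eE normcE_real ltcR normc_distC.
Qed.

Lemma cvg_normc_le u l (M : nat -> R) : (forall n, normc (u n - l) <= M n) ->
  M @ \oo --> (0 : R) -> u @ \oo --> l.
Proof.
move=> uM M0; apply/cvg_normcP.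
apply: (squeeze_cvgr _ (cvg_cst (0 : R)) M0).
by apply: nearW => n; rewrite normc_ge0 uM.
Qed.

Lemma cvg_normc u l : u @ \oo --> l -> (fun n => normc (u n)) @ \oo --> normc l.
Proof.
move=> /cvg_normcP ul; apply/cvgrPdist_lt => e e0.
move/cvgrPdist_lt: ul => /(_ e e0); apply: filterS => n.
rewrite sub0r normrN ger0_norm ?normc_ge0//; apply: le_lt_trans.
have := ler_normcD (u n - l) l; have := ler_normcD (l - u n) (u n).
by rewrite !subrK (normc_distC l) ler_norml => h1 h2; apply/andP; split; lra.
Qed.

Lemma normc_cvg_le u l (M : R) : u @ \oo --> l ->
  (forall n, normc (u n) <= M) -> normc l <= M.
Proof.
move=> /cvg_normc ul uM; rewrite -(cvg_lim _ ul)//.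
by apply: limr_le; [apply/cvg_ex; eexists; exact: ul|apply: nearW].
Qed.

Lemma normc_le_ReIm x : normc x <= `|complex.Re x| + `|complex.Im x|.
Proof.
have := ler_normcD (complex.Re x)%:C ('i * (complex.Im x)%:C).
rewrite -complexE normcM => /le_trans; apply.
by rewrite /normc /= !expr0n !expr1n /= !addr0 add0r sqrtr1 mul1r !sqrtr_sqr.
Qed.

Lemma Re_le_normc x : `|complex.Re x| <= normc x.
Proof. by have := normc_ge_Re x; rewrite normcE_real lecR. Qed.

Lemma Im_le_normc x : `|complex.Im x| <= normc x.
Proof.
have := Re_le_normc (x * 'i); rewrite ReiNIm normrN normcM.
by rewrite /normc /= expr0n expr1n add0r sqrtr1 mulr1.
Qed.

Lemma Re_series u n : complex.Re (series u n) = series (@complex.Re R \o u) n.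
Proof. exact: (big_morph _ (@raddfD _ _ (@complex.Re R : Rcomplex R -> R)) erefl). Qed.

Lemma Im_series u n : complex.Im (series u n) = series (@complex.Im R \o u) n.
Proof. exact: (big_morph _ (@raddfD _ _ (@complex.Im R : Rcomplex R -> R)) erefl). Qed.

(** Completeness of the complex numbers enters here only: the real and the
    imaginary parts are dominated by the same real series. *)
Lemma dominated_series_cvg u (M : nat -> R) :
  (forall n, normc (u n) <= M n) -> cvgn (series M) -> cvgn (series u).
Proof.
move=> uM cM.
have real_case (f : R[i] -> R) : (forall x, `|f x| <= normc x) ->
    cvgn (series (f \o u)).
  move=> fle; apply: normed_cvg; apply: (series_le_cvg _ _ _ cM) => n //=.
    exact: le_trans (normc_ge0 _) (uM n).
  exact: le_trans (fle _) (uM n).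
have /cvg_ex[/= a ha] := real_case _ Re_le_normc.
have /cvg_ex[/= b hb] := real_case _ Im_le_normc.
apply/cvg_ex; exists (a +i* b).
apply: (@cvg_normc_le _ _ (fun n => `|series (@complex.Re R \o u) n - a|
    + `|series (@complex.Im R \o u) n - b|)).
  move=> n; apply: le_trans (normc_le_ReIm _) _.
  rewrite -Re_series -Im_series.
  by case: (series u n).
have dist0 (f : nat -> R) t : f @ \oo --> t -> (fun n => `|f n - t|) @ \oo --> (0 : R).
  move=> ft; rewrite -(@normr0 _ R) -(subrr t); apply: cvg_norm.
  by apply: cvgB => //; exact: cvg_cst.
by rewrite -[0 : R]addr0; apply: cvgD; apply: dist0.
Qed.

End ComplexSequences.

Section ComplexSeries.
Context {R : realType}.
Implicit Types (x y l : R[i]) (u v : nat -> R[i]) (M : nat -> R).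

Lemma limn_eq u l : u @ \oo --> l -> limn u = l.
Proof. by move=> ul; apply: cvg_lim => //; exact: norm_hausdorff. Qed.

Lemma cvg_uniqueC u l l' : u @ \oo --> l -> u @ \oo --> l' -> l = l'.
Proof. by move=> /limn_eq <- /limn_eq. Qed.

Lemma is_cvgC u l : u @ \oo --> l -> cvgn u.
Proof. by move=> h; apply/cvg_ex; exists l. Qed.

Lemma cvgDC u v (a b : R[i]) : u @ \oo --> a -> v @ \oo --> b ->
  (fun n => u n + v n) @ \oo --> a + b.
Proof. by move=> ua vb; exact: (cvgD ua vb). Qed.

Lemma cvgBC u v (a b : R[i]) : u @ \oo --> a -> v @ \oo --> b ->
  (fun n => u n - v n) @ \oo --> a - b.
Proof. by move=> ua vb; exact: (cvgB ua vb). Qed.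

Lemma cvgMC u v (a b : R[i]) : u @ \oo --> a -> v @ \oo --> b ->
  (fun n => u n * v n) @ \oo --> a * b.
Proof. by move=> ua vb; exact: (cvgM ua vb). Qed.

Lemma cvg_shiftC u k (a : R[i]) : u @ \oo --> a -> (fun n => u (n + k)%N) @ \oo --> a.
Proof. by move=> ua; rewrite (cvg_shiftn k). Qed.

Lemma abs_cvg_normc u : cvgn [normed series u] -> cvgn (series (@normc R \o u)).
Proof.
move=> /cvg_ex[/= l hl]; apply/cvg_ex; exists (complex.Re l).
apply/cvgrPdist_lt => e e0; move/cvg_normcP/cvgrPdist_lt: hl => /(_ e e0).
apply: filterS => n; rewrite sub0r normrN ger0_norm ?normc_ge0//.
apply: le_lt_trans; rewrite distrC.
suff -> : series (@normc R \o u) n = complex.Re ([normed series u] n).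
  by rewrite -(raddfB (@complex.Re R : Rcomplex R -> R)); exact: Re_le_normc.
rewrite Re_series; apply: eq_bigr => k _ /=.
exact: (esym (congr1 (@complex.Re R) (normcE_real (u k)))).
Qed.

Lemma limn_series_tail u M K : (forall n, normc (u n) <= M n) ->
  cvgn (series M) ->
  normc (limn (series u) - series u K) <= limn (series M) - series M K.
Proof.
move=> uM cM; have cu := dominated_series_cvg _ _ uM cM.
have cvg1 : (fun n => normc (series u n - series u K)) @ \oo -->
    normc (limn (series u) - series u K).
  by apply: cvg_normc; apply: cvgB; [exact: cu|exact: cvg_cst].
have cvg2 : (fun n => series M n - series M K) @ \oo -->
    limn (series M) - series M K by apply: cvgB; [exact: cM|exact: cvg_cst].
rewrite -(cvg_lim _ cvg1)// -(cvg_lim _ cvg2)//.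
apply: ler_lim; [exact: cvgP cvg1|exact: cvgP cvg2|].
exists K => // n /= Kn.
by rewrite !sub_series_geq// (le_trans (ler_normc_sum _ _ _))// ler_sum.
Qed.

Lemma cvg_partial_series (f : nat -> nat -> R[i]) (g : nat -> R[i]) K :
  (forall n, f ^~ n @ \oo --> g n) ->
  (fun m => series (f m) K) @ \oo --> series g K.
Proof.
move=> fg; elim: K => [|K IH].
  rewrite /series /= big_geq//.
  by under eq_fun do rewrite big_geq//; exact: cvg_cst.
rewrite seriesSr; under eq_fun do rewrite seriesSr.
by apply: cvgD; [exact: IH|exact: fg].
Qed.

(** Tannery's theorem: beyond a suitable rank [K] both series are within the tail
    of the dominating series, and the first [K] terms converge one by one. *)
Lemma tannery (f : nat -> nat -> R[i]) (g : nat -> R[i]) M :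
  (forall m n, normc (f m n) <= M n) -> cvgn (series M) ->
  (forall n, f ^~ n @ \oo --> g n) ->
  (fun m => limn (series (f m))) @ \oo --> limn (series g).
Proof.
move=> fM cM fg.
have gM n : normc (g n) <= M n by apply: normc_cvg_le (fg n) _ => m.
apply/cvg_normcP/cvgrPdist_lt => e e0.
have e3 : 0 < e / 3 by rewrite divr_gt0.
have /cvgrPdist_lt/(_ _ e3)[K _ /(_ K (leqnn K))/= tailK] := cM.
have /cvg_normcP/cvgrPdist_lt/(_ _ e3) := cvg_partial_series _ _ K fg.
apply: filterS => m; rewrite !sub0r !normrN !ger0_norm ?normc_ge0// => mid.
have h1 := limn_series_tail _ _ K (fM m) cM.
have h2 := limn_series_tail _ _ K gM cM; rewrite normc_distC in h2.
have h3 := ler_norm (limn (series M) - series M K).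
have normcD3 (a b c d : R[i]) : normc (a - d) <= normc (a - b) + normc (b - c) + normc (c - d).
  by rewrite -(subrKA b) -(subrKA c b) addrA (le_trans (ler_normcD _ _))// lerD2r ler_normcD.
apply: le_lt_trans (normcD3 _ (series (f m) K) (series g K) _) _; lra.
Qed.

(** The triangle [n <= N < L] splits into the rows [r < L - n] with [N = n + r].
    Each row converges as [L] grows, and Tannery's theorem takes the limit of
    the sum of the rows. *)
Lemma triangular_double_series (F : nat -> nat -> R[i]) (M : nat -> R) (rho : R) :
  0 <= rho < 1 -> cvgn (series M) ->
  (forall n r, normc (F n r) <= M n * rho ^+ r) ->
  series (fun N => \sum_(n < N.+1) F n (N - n)%N) @ \oo -->
  limn (series (fun n => limn (series (F n)))).
Proof.
move=> /andP[rho0 rho1] cM FM.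
pose G L n := if (n < L)%N then series (F n) (L - n)%N else 0.
have cgeo (t : R) : cvgn (series (geometric t rho)).
  by apply: is_cvg_geometric_series; rewrite ger0_norm.
have M0 n : 0 <= M n by have := FM n 0; rewrite expr0 mulr1; apply: le_trans (normc_ge0 _).
have diag L : \sum_(0 <= i < L) series (F i) (L - i)%N =
    series (fun N => \sum_(n < N.+1) F n (N - n)%N) L.
  elim: L => [|L IH]; first by rewrite /series /= !big_geq.
  rewrite seriesSr -IH big_nat_recr//= subSnn /series /= big_nat1.
  rewrite big_ord_recr /= subnn addrA; congr (_ + _).
  rewrite !big_mkord -big_split /=; apply: eq_bigr => i _.
  by rewrite subSn ?(ltnW (ltn_ord i))// big_nat_recr.
have partial_le n L : normc (series (F n) L) <= M n / (1 - rho).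
  rewrite /series /=; apply: le_trans (ler_normc_sum _ _ _) _.
  apply: (@le_trans _ _ (series (geometric (M n) rho) L)); first exact: ler_sum.
  rewrite geometric_seriesE ?lt_eqF//.
  rewrite ler_pdivrMr ?subr_gt0// divfK ?subr_eq0 ?gt_eqF//.
  by rewrite ler_piMr// gerBl exprn_ge0.
have cF n : cvgn (series (F n)).
  by apply: (dominated_series_cvg _ (geometric (M n) rho)) (cgeo _).
have tan : (fun L => limn (series (G L))) @ \oo -->
    limn (series (fun n => limn (series (F n)))).
  apply: (tannery _ _ (fun n => M n / (1 - rho))).
  - move=> L n; rewrite /G; case: ifP => _; first exact: partial_le.
    by rewrite normc0 divr_ge0// subr_ge0 ltW.
  - rewrite (_ : (fun n => _) = (1 - rho)^-1 *: M); last first.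
      by apply/funext => n; rewrite /= mulrC.
    exact: is_cvg_seriesZ.
  - move=> n; rewrite -(cvg_shiftn n.+1).
    have -> : (fun k => G (k + n.+1)%N n) = (fun k => series (F n) (k + 1)%N).
      apply/funext => k; rewrite /G ltn_addl// addnS subSn ?leq_addl//.
      by rewrite addnK addn1.
    by rewrite (cvg_shiftn 1%N); exact: cF.
apply: cvg_trans tan; apply: near_eq_cvg; near=> L.
rewrite (limn_eq _ (series (G L) L)); last first.
  rewrite -(cvg_shiftn L).
  have -> : (fun n => series (G L) (n + L)%N) = cst (series (G L) L).
    apply/funext => n; rewrite series_addn /= big_nat_cond big1 ?addr0//.
    by move=> i; rewrite andbT => /andP[Li _]; rewrite /G ltnNge Li.
  exact: cvg_cst.
have -> k : series (G L) k = \sum_(0 <= i < k) G L i by [].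
have -> : \sum_(0 <= i < L) G L i = \sum_(0 <= i < L) series (F i) (L - i)%N.
  by apply: eq_big_nat => i /andP[_ iL]; rewrite /G iL.
by rewrite diag.
Unshelve. all: by end_near.
Qed.

End ComplexSeries.

(** * q-Pochhammer symbols *)

Section FiniteQPochhammer.
Context {C : numClosedFieldType}.
Implicit Types x q : C.

Lemma qpoch0 x q : qpoch x q 0 = 1.
Proof. by rewrite /qpoch big_ord0. Qed.

Lemma qpochS x q n : qpoch x q n.+1 = qpoch x q n * (1 - x * q ^+ n).
Proof. by rewrite /qpoch big_ord_recr. Qed.

Lemma qpochSl x q n : qpoch x q n.+1 = (1 - x) * qpoch (x * q) q n.
Proof.
rewrite /qpoch big_ord_recl expr0 mulr1; congr (_ * _).
by apply: eq_bigr => i _; rewrite -mulrA -exprS.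
Qed.

Lemma qpochD x q m n : qpoch x q (m + n) = qpoch x q m * qpoch (x * q ^+ m) q n.
Proof.
elim: n => [|n IH]; first by rewrite addn0 qpoch0 mulr1.
by rewrite addnS !qpochS IH exprD !mulrA.
Qed.

Lemma qpoch_neq0 x q n :
  (forall j : nat, 1 - x * q ^+ j != 0) -> qpoch x q n != 0.
Proof. by move=> hx; apply/prodf_neq0 => i _; exact: hx. Qed.

Lemma qpoch_dissect x q n :
  qpoch x q (n + n) = qpoch x (q ^+ 2) n * qpoch (x * q) (q ^+ 2) n.
Proof.
elim: n => [|n IH]; first by rewrite !qpoch0 mulr1.
rewrite addSn addnS !qpochS IH -!exprM mul2n -addnn (exprS q (n + n)).
by ring.
Qed.

Lemma qpoch_sqr x q n : qpoch (x ^+ 2) (q ^+ 2) n = qpoch x q n * qpoch (- x) q n.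
Proof.
elim: n => [|n IH]; first by rewrite !qpoch0 mulr1.
by rewrite !qpochS IH -exprM mulnC exprM; ring.
Qed.

End FiniteQPochhammer.

Section InfiniteQPochhammer.
Context {R : realType}.
Implicit Types x y q : R[i].

(** From [1 + t <= exp t]; monotone in [normc x], hence also a bound for every
    product shifted to [x * q ^+ m]. *)
Definition qpoch_bound q x : R := expR (normc x / (1 - normc q)).

Lemma qpoch_bound_ge0 q x : 0 <= qpoch_bound q x.
Proof. exact: expR_ge0. Qed.

Lemma qpoch_bound_le q x y : normc q < 1 -> normc x <= normc y ->
  qpoch_bound q x <= qpoch_bound q y.
Proof. by move=> q1 xy; rewrite ler_expR ler_pM2r// invr_gt0 subr_gt0. Qed.

Lemma normcXq_le q x n : normc q < 1 -> normc (x * q ^+ n) <= normc x.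
Proof.
move=> q1; rewrite normcM normcX ler_piMr ?normc_ge0//.
by rewrite exprn_ile1 ?normc_ge0// ltW.
Qed.

Lemma normc_qpoch_le q x n : normc q < 1 -> normc (qpoch x q n) <= qpoch_bound q x.
Proof.
move=> q1; apply: (@le_trans _ _
    (expR (\sum_(0 <= j < n) normc x * normc q ^+ j))).
  elim: n => [|n IH]; first by rewrite qpoch0 normc1 big_geq// expR0.
  rewrite qpochS normcM big_nat_recr//= expRD ler_pM ?normc_ge0//.
  apply: le_trans (expR_ge1Dx _); rewrite (le_trans (ler_normcD _ _))//.
  by rewrite normc1 normcN normcM normcX.
rewrite ler_expR -[X in X <= _]/(series (geometric (normc x) (normc q)) n).
rewrite geometric_seriesE ?lt_eqF//=.
rewrite ler_pM2r ?invr_gt0 ?subr_gt0//.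
by rewrite ler_piMr ?normc_ge0// gerBl exprn_ge0 ?normc_ge0.
Qed.

Lemma cvgn_geometric q (t : R) : normc q < 1 ->
  cvgn (series (geometric t (normc q))).
Proof. by move=> q1; apply: is_cvg_geometric_series; rewrite ger0_norm ?normc_ge0. Qed.

Lemma qpoch_step_le q x n : normc q < 1 ->
  normc (qpoch x q n.+1 - qpoch x q n) <=
  geometric (normc x * qpoch_bound q x) (normc q) n.
Proof.
move=> q1; rewrite qpochS mulrBr mulr1 addrC addKr normcN !normcM normcX /=.
rewrite mulrC -!mulrA ler_wpM2l ?normc_ge0// mulrC.
by rewrite ler_wpM2r ?exprn_ge0 ?normc_ge0// normc_qpoch_le.
Qed.

Lemma cvg_qpoch q x : normc q < 1 -> qpoch x q @ \oo --> qpoch_oo x q.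
Proof.
move=> q1; suff : cvgn (qpoch x q) by [].
have : cvgn (series (telescope (qpoch x q))).
  by apply: (dominated_series_cvg _ _ _ (cvgn_geometric _ _ q1)) => n; exact: qpoch_step_le.
move=> /cvg_ex[/= l hl]; apply: (is_cvgC _ (l + 1)).
have -> : qpoch x q = (fun n => series (telescope (qpoch x q)) n + 1).
  by apply/funext => n; rewrite telescopeK qpoch0 subrK.
by apply: cvgDC; [exact: hl|exact: cvg_cst].
Qed.

(** The bound is linear in [normc x] for small [x], which gives both continuity at
    0 and the lower bound on the tail of a product. *)
Lemma qpoch_sub1_le q x n : normc q < 1 ->
  normc (qpoch x q n - 1) <= normc x * qpoch_bound q x / (1 - normc q).
Proof.
move=> q1; have -> : qpoch x q n - 1 = series (telescope (qpoch x q)) n.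
  by rewrite telescopeK qpoch0.
apply: le_trans (ler_normc_sum _ _ _) _.
apply: le_trans (ler_sum _ (fun i _ => qpoch_step_le q x i q1)) _.
rewrite -[X in X <= _]/(series (geometric (normc x * qpoch_bound q x) (normc q)) n).
rewrite geometric_seriesE ?lt_eqF//=.
rewrite ler_pM2r ?invr_gt0 ?subr_gt0//.
rewrite ler_piMr ?mulr_ge0 ?normc_ge0 ?qpoch_bound_ge0//.
by rewrite gerBl exprn_ge0 ?normc_ge0.
Qed.

Lemma qpoch_ooD q x m : normc q < 1 ->
  qpoch_oo x q = qpoch x q m * qpoch_oo (x * q ^+ m) q.
Proof.
move=> q1; apply: (cvg_uniqueC (fun n => qpoch x q (n + m)%N)).
  by rewrite (cvg_shiftn m); exact: cvg_qpoch.
under eq_fun do rewrite addnC qpochD.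
by apply: cvgMC; [exact: cvg_cst|exact: cvg_qpoch].
Qed.

Lemma normc_qpoch_oo_le q x : normc q < 1 -> normc (qpoch_oo x q) <= qpoch_bound q x.
Proof.
by move=> q1; apply: normc_cvg_le (cvg_qpoch q x q1) _ => n; exact: normc_qpoch_le.
Qed.

Lemma cvg_qpoch_oo0 q (u : nat -> R[i]) : normc q < 1 ->
  u @ \oo --> (0 : R[i]) -> (fun m => qpoch_oo (u m) q) @ \oo --> (1 : R[i]).
Proof.
move=> q1 u0.
have nu0 := cvg_normc _ _ u0; rewrite normc0 in nu0.
apply: (cvg_normc_le _ _
  (fun m => normc (u m) * qpoch_bound q (u m) / (1 - normc q))).
  move=> m; apply: (normc_cvg_le (fun n => qpoch (u m) q n - 1) (qpoch_oo (u m) q - 1)).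
    by apply: cvgBC; [exact: cvg_qpoch|exact: cvg_cst].
  by move=> n; exact: qpoch_sub1_le.
rewrite -(mul0r (1 - normc q)^-1); apply: cvgM; last exact: cvg_cst.
rewrite -(mul0r (expR 0)); apply: cvgM; first exact: nu0.
apply: (cvg_comp (fun m => normc (u m) / (1 - normc q)) expR) (@continuous_expR R 0).
by rewrite -(mul0r (1 - normc q)^-1); apply: cvgM; [exact: nu0|exact: cvg_cst].
Qed.

Lemma cvg_expq q x : normc q < 1 -> (fun m => x * q ^+ m) @ \oo --> (0 : R[i]).
Proof.
move=> q1; apply: (cvg_normc_le _ _ (geometric (normc x) (normc q))).
  by move=> n; rewrite subr0 normcM normcX.
by apply: cvg_geometric; rewrite ger0_norm ?normc_ge0.
Qed.

(** Deep in the product the factors are so close to 1 that the tail is at least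
    1/2 in norm; only the finitely many others could be small, and none is 0. *)
Lemma qpoch_bounded_below q x : normc q < 1 ->
  (forall j : nat, 1 - x * q ^+ j != 0) ->
  exists2 d : R, 0 < d & forall n, d <= normc (qpoch x q n).
Proof.
move=> q1 hx; set E := qpoch_bound q x.
have E0 : 0 < E by exact: expR_gt0.
pose t := (1 - normc q) / (2 * E).
have t0 : 0 < t by rewrite divr_gt0 ?subr_gt0// mulr_gt0.
have /cvg_normcP/cvgrPdist_lt/(_ _ t0)[J _ /(_ J (leqnn J))] := cvg_expq q x q1.
rewrite /= sub0r normrN subr0 ger0_norm ?normc_ge0// => xJ.
have PJ : 0 < normc (qpoch x q J).
  rewrite lt_def normc_ge0 andbT; apply: contra_neq (qpoch_neq0 x q J hx).
  exact: eq0_normc.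
have half n : 1 / 2 <= normc (qpoch (x * q ^+ J) q n).
  have := ler_normcD (1 - qpoch (x * q ^+ J) q n) (qpoch (x * q ^+ J) q n).
  rewrite subrK normc1 normc_distC.
  have := qpoch_sub1_le q (x * q ^+ J) n q1.
  suff : normc (x * q ^+ J) * qpoch_bound q (x * q ^+ J) / (1 - normc q) <= 1 / 2 by lra.
  rewrite ler_pdivrMr ?subr_gt0//.
  apply: (@le_trans _ _ (t * E)).
    rewrite ler_pM ?normc_ge0 ?qpoch_bound_ge0//; first exact: ltW.
    by apply: qpoch_bound_le => //; exact: normcXq_le.
  by rewrite /t invfM mulrA -mulrA mulVf ?gt_eqF// mulr1 mulrC div1r.
exists (Num.min (normc (qpoch x q J) / 2) (normc (qpoch x q J) / E)).
  by rewrite lt_min !divr_gt0.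
move=> n; rewrite ge_min; case: (leqP J n) => Jn; apply/orP; [left|right].
  rewrite -(subnKC Jn) qpochD normcM ler_wpM2l ?normc_ge0//.
  by rewrite -div1r.
rewrite ler_pdivrMr// -(subnKC (ltnW Jn)) qpochD normcM ler_wpM2l ?normc_ge0//.
apply: le_trans (normc_qpoch_le _ _ _ q1) _.
by apply: qpoch_bound_le => //; exact: normcXq_le.
Qed.

Lemma qpoch_oo_neq0 q x : normc q < 1 ->
  (forall j : nat, 1 - x * q ^+ j != 0) -> qpoch_oo x q != 0.
Proof.
move=> q1 hx; have [d d0 hd] := qpoch_bounded_below q x q1 hx.
apply: contraTneq d0 => x0; rewrite -leNgt -(normc0 R) -x0.
rewrite -(cvg_lim _ (cvg_normc _ _ (cvg_qpoch q x q1)))//.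
apply: limr_ge; first exact: cvgP (cvg_normc _ _ (cvg_qpoch q x q1)).
exact: nearW.
Qed.

Lemma normc_sqr_lt1 q : normc q < 1 -> normc (q ^+ 2) < 1.
Proof. by move=> q1; rewrite normcX expr_lt1// normc_ge0. Qed.

Lemma qpoch_oo_dissect q x : normc q < 1 ->
  qpoch_oo x q = qpoch_oo x (q ^+ 2) * qpoch_oo (x * q) (q ^+ 2).
Proof.
move=> q1; have q2 := normc_sqr_lt1 _ q1.
apply: (cvg_uniqueC (fun n => qpoch x q (n + n)%N)).
  have := cvg_qpoch q x q1; apply: cvg_comp => A [N _ NA]; exists N => // n /= Nn.
  by apply: NA => /=; rewrite (leq_trans Nn)// leq_addr.
under eq_fun do rewrite qpoch_dissect.
by apply: cvgMC; exact: cvg_qpoch.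
Qed.

Lemma qpoch_oo_sqr q x : normc q < 1 ->
  qpoch_oo (x ^+ 2) (q ^+ 2) = qpoch_oo x q * qpoch_oo (- x) q.
Proof.
move=> q1; apply: (cvg_uniqueC (qpoch (x ^+ 2) (q ^+ 2))).
  exact/cvg_qpoch/normc_sqr_lt1.
have -> : qpoch (x ^+ 2) (q ^+ 2) = (fun n => qpoch x q n * qpoch (- x) q n).
  by apply/funext => n; exact: qpoch_sqr.
by apply: cvgMC; exact: cvg_qpoch.
Qed.

End InfiniteQPochhammer.

(** * Jackson's terminating sum *)

Section JacksonSum.
Context {C : numClosedFieldType}.
Implicit Types q a k c x t y z w : C.

(** The polynomial identity behind the telescoping in [jackson_telescope];
    [x] and [t] stand for [q ^+ n] and [q ^+ (N - n)]. *)
Lemma jackson_certificate q k c y z x t (a := c * k) (w := c ^+ 2 * k * q / (y * z)) :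
  c != 0 -> k != 0 -> q != 0 -> y != 0 -> z != 0 ->
  (1 - q * (x * t)) * (1 - a * q / y * (x * t)) * (1 - a * q / z * (x * t))
    * (1 - a * q / w * (x * t)) * (1 - k * (x * x)) * (1 - a * (x * t * x)) * (1 - c * t)
  - (1 - a * (x * t)) * (1 - y * (x * t)) * (1 - z * (x * t)) * (1 - w * (x * t))
    * (1 - k * (x * x)) * (1 - q * t) * (1 - k * q * (x * t * x))
  = - (1 - a * q * (x * t * (x * t))) *
    (t * (c * (1 - k * x) * (1 - y / c * x) * (1 - z / c * x) * (1 - w / c * x))
       * (1 - a * (x * t * x)) * (1 - q * t)
     - q * t * ((1 - x) * (1 - a / y * x) * (1 - a / z * x) * (1 - a / w * x))
       * (1 - c * t) * (1 - k * q * (x * t * x))).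
Proof. by move=> c0 k0 q0 y0 z0; rewrite /w /a; field; rewrite c0 k0 q0 y0 z0. Qed.

Variables (q k c y z : C).
Let a := c * k.
Let w := c ^+ 2 * k * q / (y * z).
Hypotheses (c0 : c != 0) (k0 : k != 0) (q0 : q != 0) (y0 : y != 0) (z0 : z != 0).
Hypothesis k1 : 1 - k != 0.
Hypothesis qN : forall j : nat, 1 - q * q ^+ j != 0.
Hypothesis kqN : forall j : nat, 1 - k * q * q ^+ j != 0.
Hypothesis yN : forall j : nat, 1 - a * q / y * q ^+ j != 0.
Hypothesis zN : forall j : nat, 1 - a * q / z * q ^+ j != 0.
Hypothesis wN : forall j : nat, 1 - a * q / w * q ^+ j != 0.

(** [wp_alpha] and [wp_beta] form a well-poised Bailey pair relative to [a = c k]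
    and [k]; [wp_kernel (N + n) (N - n)] is the kernel that expresses the first
    through the second.  [wp_ratio] omits the very-well-poised factor
    of [wp_beta], which does not occur in the certificate. *)
Definition wp_ratio n : C :=
  qpoch k q n * qpoch (y / c) q n * qpoch (z / c) q n * qpoch (w / c) q n * c ^+ n
  / ((1 - k) * qpoch q q n * qpoch (a * q / y) q n * qpoch (a * q / z) q n
     * qpoch (a * q / w) q n).

Definition wp_beta n : C := wp_ratio n * (1 - k * (q ^+ n * q ^+ n)).

Definition wp_kernel M r : C :=
  qpoch a q M * qpoch c q r / (qpoch q q r * qpoch (k * q) q M).

Definition wp_alpha N : C :=
  qpoch a q N * qpoch y q N * qpoch z q N * qpoch w q N
  / (qpoch q q N * qpoch (a * q / y) q N * qpoch (a * q / z) q N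
     * qpoch (a * q / w) q N).

(** The summand divided by [wp_alpha N] does not change its sum over [n] when [N]
   increases; [cert] is the Wilf-Zeilberger certificate of this, with the
   denominators of [wp_alpha N.+1 / wp_alpha N] cleared. *)
Let cert N n : C :=
  - (1 - a * q * (q ^+ N * q ^+ N)) * q ^+ (N.+1 - n) * wp_ratio n
  * ((1 - q ^+ n) * (1 - a / y * q ^+ n) * (1 - a / z * q ^+ n) * (1 - a / w * q ^+ n))
  * wp_kernel (N + n) (N.+1 - n).

Let num N := (1 - a * q ^+ N) * (1 - y * q ^+ N) * (1 - z * q ^+ N) * (1 - w * q ^+ N).
Let den N := (1 - q * q ^+ N) * (1 - a * q / y * q ^+ N) * (1 - a * q / z * q ^+ N)
  * (1 - a * q / w * q ^+ N).

Lemma wp_ratioS n :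
  wp_ratio n.+1 * ((1 - q ^+ n.+1) * (1 - a / y * q ^+ n.+1)
     * (1 - a / z * q ^+ n.+1) * (1 - a / w * q ^+ n.+1))
  = wp_ratio n * (c * (1 - k * q ^+ n) * (1 - y / c * q ^+ n)
     * (1 - z / c * q ^+ n) * (1 - w / c * q ^+ n)).
Proof.
have ratio_step v : a / v * q ^+ n.+1 = a * q / v * q ^+ n by rewrite exprS; ring.
rewrite !ratio_step /wp_ratio !qpochS (exprS q n) (exprS c n).
have := (qN n, yN n, zN n, wN n, qpoch_neq0 _ _ n qN, qpoch_neq0 _ _ n yN,
  qpoch_neq0 _ _ n zN, qpoch_neq0 _ _ n wN).
set qy := a * q / y; set qz := a * q / z; set qw := a * q / w.
set yc := y / c; set zc := z / c; set wc := w / c.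
case=> -[[[[[[[n1 n2] n3] n4] n5] n6] n7] n8].
by field; rewrite n1 n2 n3 n4 n5 n6 n7 n8 k1.
Qed.

Lemma jackson_telescope n r (N := (n + r)%N) :
  den N * (wp_beta n * wp_kernel (N.+1 + n) (N.+1 - n))
  - num N * (wp_beta n * wp_kernel (N + n) (N - n)) = cert N n.+1 - cert N n.
Proof.
have -> : (N.+1 - n = r.+1)%N by rewrite /N -addnS addKn.
rewrite /cert subSS.
have -> : (N - n = r)%N by rewrite /N addKn.
have -> : (N.+1 - n = r.+1)%N by rewrite /N -addnS addKn.
rewrite addSn addnS.
have := wp_ratioS n.
rewrite /wp_beta; move: (wp_ratio n) (wp_ratio n.+1) => F F1 F1E.
pose T0 := qpoch a q (N + n) * qpoch c q r / (qpoch q q r.+1 * qpoch (k * q) q (N + n).+1).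
have := (qN r, kqN (N + n), qpoch_neq0 _ _ r qN, qpoch_neq0 _ _ (N + n) kqN).
case=> -[[n1 n2] n3] n4.
have T11 : wp_kernel (N + n).+1 r.+1 = T0 * ((1 - a * q ^+ (N + n)) * (1 - c * q ^+ r)).
  by rewrite /wp_kernel /T0 !qpochS; field; rewrite n1 n2 n3 n4.
have T00 : wp_kernel (N + n) r = T0 * ((1 - q * q ^+ r) * (1 - k * q * q ^+ (N + n))).
  by rewrite /wp_kernel /T0 !qpochS; field; rewrite n1 n2 n3 n4.
have T01 : wp_kernel (N + n) r.+1 = T0 * ((1 - c * q ^+ r) * (1 - k * q * q ^+ (N + n))).
  by rewrite /wp_kernel /T0 !qpochS; field; rewrite n1 n2 n3 n4.
have T10 : wp_kernel (N + n).+1 r = T0 * ((1 - a * q ^+ (N + n)) * (1 - q * q ^+ r)).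
  by rewrite /wp_kernel /T0 !qpochS; field; rewrite n1 n2 n3 n4.
rewrite T11 T00 T01 T10.
rewrite -(mulrA (- _ * _) F1) F1E.
have := jackson_certificate q k c y z (q ^+ n) (q ^+ r) c0 k0 q0 y0 z0.
rewrite -/a -/w /den /num.
have -> : q ^+ N = q ^+ n * q ^+ r by rewrite -exprD.
have -> : q ^+ (N + n) = q ^+ n * q ^+ r * q ^+ n by rewrite -!exprD.
rewrite exprS.
set qy := a * q / y; set qz := a * q / z; set qw := a * q / w.
set yc := y / c; set zc := z / c; set wc := w / c.
set ay := a / y; set az := a / z; set aw := a / w.
move: (q ^+ n) (q ^+ r) => x t /(congr1 ( *%R (F * T0))) h.
rewrite [LHS](_ : _ = F * T0 *
 ((1 - q * (x * t)) * (1 - qy * (x * t)) * (1 - qz * (x * t))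
    * (1 - qw * (x * t)) * (1 - k * (x * x)) * (1 - a * (x * t * x)) * (1 - c * t)
  - (1 - a * (x * t)) * (1 - y * (x * t)) * (1 - z * (x * t)) * (1 - w * (x * t))
    * (1 - k * (x * x)) * (1 - q * t) * (1 - k * q * (x * t * x)))); last by ring.
by rewrite h; ring.
Qed.

(** The term [n = N.+1], absent from the sum at level [N], cancels the value left
    over by the telescoping. *)
Lemma jackson_boundary N :
  den N * (wp_beta N.+1 * wp_kernel (N.+1 + N.+1) 0) + cert N N.+1 = 0.
Proof.
rewrite /cert subnn expr0 addSn addnS /wp_beta /den.
have ratio_step v : a * q / v * q ^+ N = a / v * q ^+ N.+1 by rewrite exprS; ring.
rewrite !ratio_step -(exprS q N).
rewrite /wp_kernel !(qpochS _ _ (N + N).+1) !qpoch0.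
have n1 := kqN (N + N).+1.
have n2 := qpoch_neq0 _ _ (N + N).+1 kqN.
have e1 : k * (q ^+ N.+1 * q ^+ N.+1) = k * q * q ^+ (N + N).+1.
  by rewrite -mulrA -exprS -addnS -addSn exprD.
have e2 : a * q * (q ^+ N * q ^+ N) = a * q ^+ (N + N).+1.
  by rewrite exprS exprD !mulrA.
rewrite e1 e2.
set ay := a / y; set az := a / z; set aw := a / w.
by field; rewrite n1 n2.
Qed.

(** Jackson's terminating very-well-poised sum.  Stated with [wp_kernel], it makes
    sense also when [c] is a negative power of [q] or [c = 1]. *)
Lemma jackson_sum N :
  \sum_(n < N.+1) wp_beta n * wp_kernel (N + n) (N - n) = wp_alpha N.
Proof.
elim: N => [|N IH].
  rewrite big_ord1 /wp_beta /wp_ratio /wp_kernel /wp_alpha !qpoch0 !expr0 !mulr1.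
  by rewrite mul1r mulVf ?k1 ?mul1r.
have denN0 : den N != 0 by rewrite /den !mulf_neq0 ?qN ?yN ?zN ?wN.
have telescoped : den N * (\sum_(n < N.+1) wp_beta n * wp_kernel (N.+1 + n) (N.+1 - n))
    - num N * wp_alpha N = cert N N.+1.
  rewrite -IH !mulr_sumr -sumrB.
  rewrite (eq_bigr (fun n : 'I_N.+1 => cert N n.+1 - cert N n)); last first.
    move=> n _; have := jackson_telescope n (N - n).
    by rewrite subnKC// -ltnS.
  rewrite -(big_mkord xpredT (fun n => cert N n.+1 - cert N n)) telescope_sumr//.
  by rewrite /cert expr0 subrr !(mul0r, mulr0) subr0.
apply: (mulfI denN0); rewrite big_ord_recr /= subnn mulrDr.
have -> : den N * wp_alpha N.+1 = num N * wp_alpha N.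
  rewrite /wp_alpha !qpochS /den /num.
  have := (qN N, yN N, zN N, wN N, qpoch_neq0 _ _ N qN, qpoch_neq0 _ _ N yN,
    qpoch_neq0 _ _ N zN, qpoch_neq0 _ _ N wN).
  set qy := a * q / y; set qz := a * q / z; set qw := a * q / w.
  case=> -[[[[[[[n1 n2] n3] n4] n5] n6] n7] n8].
  by field; rewrite n1 n2 n3 n4 n5 n6 n7 n8.
have := jackson_boundary N; move/eqP; rewrite addrC addr_eq0 => /eqP bd.
by move: telescoped; rewrite bd => /eqP; rewrite subr_eq => /eqP ->; ring.
Qed.

End JacksonSum.

(** * A nonterminating sum in mixed bases *)

Section MixedBaseSum.
Context {R : realType}.
Variable q : R[i].
Hypothesis q1 : normc q < 1.
Let q21 : normc (q ^+ 2) < 1 := normc_sqr_lt1 _ q1.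
Implicit Types (b c x u : R[i]).

Lemma normc_lt1_factor_neq0 x j : normc x < 1 -> 1 - x * q ^+ j != 0.
Proof.
move=> x1; rewrite subr_eq0; apply: contraTneq (le_lt_trans (normcXq_le q x j q1) x1).
by move=> <-; rewrite normc1 ltxx.
Qed.

Lemma qfactor_neq0 j : 1 - q * q ^+ j != 0.
Proof. exact: normc_lt1_factor_neq0. Qed.

Lemma qpoch_oo_step p x : normc p < 1 -> qpoch_oo x p = (1 - x) * qpoch_oo (x * p) p.
Proof. by move=> p1; rewrite (qpoch_ooD p x 1 p1) qpochSl qpoch0 mulr1 expr1. Qed.

Lemma cvg_qpoch0 p (u : nat -> R[i]) n : normc p < 1 ->
  u @ \oo --> (0 : R[i]) -> (fun m => qpoch (u m) p n) @ \oo --> (1 : R[i]).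
Proof.
move=> p1 u0; elim: n => [|n IH].
  by under eq_fun do rewrite qpoch0; exact: cvg_cst.
under eq_fun do rewrite qpochS.
have factor1 : (fun m => 1 - u m * p ^+ n) @ \oo --> (1 - 0 * p ^+ n : R[i]).
  by apply: cvgBC; [exact: cvg_cst|apply: cvgMC; [exact: u0|exact: cvg_cst]].
by have := cvgMC _ _ _ _ IH factor1; rewrite mul0r subr0 mulr1.
Qed.

(** [qpoch_alt b N] is [(b; q)_oo / (b q^N; q^2)_oo], written so that it makes
    sense even when [b] is a power of [q] with nonpositive exponent, where the
    quotient can be 0/0. *)
Definition qpoch_alt b N := qpoch b q N * qpoch_oo (b * q ^+ N.+1) (q ^+ 2).

Lemma qpoch_altSS b N : qpoch_alt b N.+2 = (1 - b * q ^+ N) * qpoch_alt b N.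
Proof.
rewrite /qpoch_alt !qpochS [in RHS](qpoch_oo_step _ _ q21).
by rewrite -(mulrA b) -exprD addn2; ring.
Qed.

Lemma qpoch_altD b n r : qpoch_alt b (n + r) = qpoch b q n * qpoch_alt (b * q ^+ n) r.
Proof. by rewrite /qpoch_alt qpochD -addnS exprD !mulrA. Qed.

Lemma normc_qpoch_alt_le b N :
  normc (qpoch_alt b N) <= qpoch_bound q b * qpoch_bound (q ^+ 2) b.
Proof.
rewrite normcM ler_pM ?normc_ge0// ?normc_qpoch_le//.
apply: le_trans (normc_qpoch_oo_le _ _ q21) _.
by apply: qpoch_bound_le => //; exact: normcXq_le.
Qed.

Lemma cvg_qpoch_alt b : qpoch_alt b @ \oo --> qpoch_oo b q.
Proof.
have tail0 : (fun N => b * q ^+ N.+1) @ \oo --> (0 : R[i]).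
  by under eq_fun do rewrite exprS mulrA; exact: cvg_expq.
by have := cvgMC _ _ _ _ (cvg_qpoch q b q1) (cvg_qpoch_oo0 _ _ q21 tail0); rewrite mulr1.
Qed.

(** Only a two-step recurrence in [N] is available, since [qpoch_alt] has one;
    the boundary terms of even and odd index do not vanish at infinity, but
    they cancel. *)
Lemma two_step_telescope (t v : nat -> R[i]) (l : R[i]) :
  t 0 = v 0 -> t 1 = - v 1 ->
  (forall N, t N.+2 = (-1) ^+ N * (v N.+2 - v N)) ->
  v @ \oo --> l -> series t @ \oo --> (0 : R[i]).
Proof.
move=> t0 t1 tS vl.
have sumE N : series t N.+2 = (-1) ^+ N * (v N - v N.+1).
  elim: N => [|N IH].
    by rewrite !seriesSr /series /= big_geq// t0 t1; ring.
  by rewrite seriesSr IH tS exprS; ring.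
rewrite -(cvg_shiftn 2) /=.
apply: (cvg_normc_le _ _ (fun N => normc (v N - v N.+1))).
  move=> N; rewrite addn2 sumE subr0 normcM normcX normcN normc1 expr1n mul1r.
  exact: lexx.
rewrite -(normc0 R); apply: cvg_normc; rewrite -(subrr l).
by apply: cvgBC; [exact: vl|rewrite (cvg_shiftS v)].
Qed.

(** With [A = b b' c^2], the terms of even index are those of the very-well-poised
    series of base [q^2] with parameters [A; b, b', A q, c, c q], and those of
    odd index form the companion series in Bailey's nonterminating form of
    Jackson's sum.  Everything is multiplied by the infinite products that clear
    the denominators depending on [b], [b'] and [c]. *)
Definition mixed_term c b b' N :=
  (- q) ^+ N * (1 - b * b' * c ^+ 2 * (q ^+ N * q ^+ N))
  * qpoch (b * b' * c ^+ 2) q N * qpoch c q N / qpoch q q N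
  * qpoch_oo (b * b' * (c * q) * q ^+ N) q
  * qpoch_oo (b * (c * q) ^+ 2 * q ^+ N) (q ^+ 2)
  * qpoch_oo (b' * (c * q) ^+ 2 * q ^+ N) (q ^+ 2)
  * (qpoch_alt b N * qpoch_alt b' N).

Definition mixed_sum c b b' := limn (series (mixed_term c b b')).

(** The two-step certificate of the relation between [c] and [c q], without its
   sign [(-1) ^+ N].  Its denominator [1 - u] is the reason why [c] must avoid the
   negative powers of [q]. *)
Let mixed_cert c b b' N :=
  let u := c * q in let A := b * b' * c ^+ 2 in
  qpoch (A * q * q) q N * qpoch (c * q) q N / qpoch q q N
  * qpoch_oo (b * b' * u * q ^+ N.+1) q
  * qpoch_oo (b * u ^+ 2 * q ^+ N.+2) (q ^+ 2)
  * qpoch_oo (b' * u ^+ 2 * q ^+ N.+2) (q ^+ 2)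
  * (qpoch_alt b N.+2 * qpoch_alt b' N.+2)
  * ((1 - A) * u / (1 - u)
     * ((1 - b * u) * (1 - b' * u) * u * q ^+ N
        - (1 - b * u ^+ 2 * q ^+ N) * (1 - b' * u ^+ 2 * q ^+ N))).

Let mixed_factor c b b' :=
  (1 - b * (c * q)) * (1 - b' * (c * q)) * (1 + c * q) * (1 - b * b' * c ^+ 2).

Lemma mixed_cert0 c b b' : 1 - c * q != 0 ->
  mixed_term c b b' 0 - mixed_factor c b b' * mixed_term (c * q) b b' 0
  = mixed_cert c b b' 0.
Proof.
move=> cq; rewrite /mixed_term /mixed_cert /mixed_factor !qpoch0 !qpoch_altSS !expr0.
rewrite (qpoch_oo_step q (b * b' * (c * q) * 1) q1).
rewrite !(qpoch_oo_step (q ^+ 2) (_ * (c * q) ^+ 2 * 1) q21).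
have -> : b * b' * (c * q * q) * 1 = b * b' * (c * q) * 1 * q by ring.
have -> : b * b' * (c * q) * q ^+ 1 = b * b' * (c * q) * 1 * q by ring.
have e2 d : d * (c * q * q) ^+ 2 * 1 = d * (c * q) ^+ 2 * 1 * q ^+ 2 by ring.
have e3 d : d * (c * q) ^+ 2 * q ^+ 2 = d * (c * q) ^+ 2 * 1 * q ^+ 2 by ring.
rewrite !e2 !e3.
set O1 := qpoch_oo _ q; set O2 := qpoch_oo _ (q ^+ 2); set O3 := qpoch_oo _ (q ^+ 2).
set H1 := qpoch_alt b _; set H2 := qpoch_alt b' _.
clear e2 e3; clearbody O1 O2 O3 H1 H2.
by field.
Qed.

Lemma mixed_cert1 c b b' : 1 - c * q != 0 ->
  mixed_term c b b' 1 - mixed_factor c b b' * mixed_term (c * q) b b' 1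
  = - mixed_cert c b b' 1.
Proof.
move=> cq; rewrite /mixed_term /mixed_cert /mixed_factor !qpoch_altSS.
rewrite !qpochS !qpoch0 !expr0 !expr1.
rewrite (qpoch_oo_step q (b * b' * (c * q) * q) q1).
rewrite !(qpoch_oo_step (q ^+ 2) (_ * (c * q) ^+ 2 * q) q21).
have -> : b * b' * (c * q * q) * q = b * b' * (c * q) * q * q by ring.
have -> : b * b' * (c * q) * q ^+ 2 = b * b' * (c * q) * q * q by ring.
have e2 d : d * (c * q * q) ^+ 2 * q = d * (c * q) ^+ 2 * q * q ^+ 2 by ring.
have e3 d : d * (c * q) ^+ 2 * q ^+ 3 = d * (c * q) ^+ 2 * q * q ^+ 2 by ring.
rewrite !e2 !e3.
set O1 := qpoch_oo _ q; set O2 := qpoch_oo _ (q ^+ 2); set O3 := qpoch_oo _ (q ^+ 2).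
set H1 := qpoch_alt b _; set H2 := qpoch_alt b' _.
clear e2 e3; clearbody O1 O2 O3 H1 H2.
have := qfactor_neq0 0; rewrite expr0 => n1.
by field; rewrite cq; rewrite mulr1 in n1; rewrite n1.
Qed.

Lemma mixed_certSS c b b' N : 1 - c * q != 0 ->
  mixed_term c b b' N.+2 - mixed_factor c b b' * mixed_term (c * q) b b' N.+2
  = (-1) ^+ N * (mixed_cert c b b' N.+2 - mixed_cert c b b' N).
Proof.
move=> cq; rewrite /mixed_term /mixed_cert /mixed_factor.
rewrite (qpoch_altSS b N.+2) (qpoch_altSS b' N.+2).
have -> : b * b' * (c * q) ^+ 2 = b * b' * c ^+ 2 * q * q by ring.
rewrite (qpochSl (b * b' * c ^+ 2) q N.+1) (qpochSl (b * b' * c ^+ 2 * q) q N).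
rewrite (qpochSl c q N.+1).
rewrite !(qpochS _ q N.+1) !(qpochS _ q N).
set x := q ^+ N.
rewrite !(exprS q N.+3) !(exprS q N.+2) !(exprS q N.+1) !(exprS q N) -/x.
rewrite (qpoch_oo_step q (b * b' * (c * q) * (q * x)) q1).
rewrite (qpoch_oo_step q (b * b' * (c * q) * (q * (q * x))) q1).
rewrite (qpoch_oo_step q (b * b' * (c * q) * (q * x) * q) q1).
rewrite !(qpoch_oo_step (q ^+ 2) (_ * (c * q) ^+ 2 * (q * (q * x))) q21).
have -> : b * b' * (c * q) * (q * (q * x)) * q = b * b' * (c * q) * (q * (q * (q * x))) by ring.
have -> : b * b' * (c * q) * (q * x) * q * q = b * b' * (c * q) * (q * (q * (q * x))) by ring.
have -> : b * b' * (c * q * q) * (q * (q * x)) = b * b' * (c * q) * (q * (q * (q * x))) by ring.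
have e2 d : d * (c * q * q) ^+ 2 * (q * (q * x)) = d * (c * q) ^+ 2 * (q * (q * x)) * q ^+ 2 by ring.
have e3 d : d * (c * q) ^+ 2 * (q * (q * (q * (q * x)))) = d * (c * q) ^+ 2 * (q * (q * x)) * q ^+ 2 by ring.
rewrite !e2 !e3.
rewrite !(exprS (- q) N.+1) !(exprS (- q) N).
have -> : (- q) ^+ N = (-1) ^+ N * x by exact: (exprNn q N).
have n1 := qfactor_neq0 N; have n2 := qfactor_neq0 N.+1; have n3 := qpoch_neq0 _ _ N qfactor_neq0.
rewrite exprS -/x in n2; rewrite -/x in n1.
set O1 := qpoch_oo _ q; set O2 := qpoch_oo _ (q ^+ 2); set O3 := qpoch_oo _ (q ^+ 2).
set H1 := qpoch_alt b _; set H2 := qpoch_alt b' _.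
move: n3; set P1 := qpoch q q N; set P2 := qpoch _ q N; set P3 := qpoch _ q N => n3.
set sgn := (-1) ^+ N.
clear e2 e3; clearbody O1 O2 O3 H1 H2 P1 P2 P3 sgn x.
by field; rewrite cq n1 n2 n3.
Qed.


Lemma qpoch_q_lower : exists2 K : R, 0 <= K & forall n, normc (qpoch q q n)^-1 <= K.
Proof.
have [d d0 dle] := qpoch_bounded_below q q q1 qfactor_neq0.
exists d^-1 => [|n]; first by rewrite invr_ge0 ltW.
by rewrite normcV lef_pV2 ?posrE// (lt_le_trans d0 (dle n)).
Qed.

Lemma cvg_qpoch_inv x : (forall j : nat, 1 - x * q ^+ j != 0) ->
  (fun n => (qpoch x q n)^-1) @ \oo --> (qpoch_oo x q)^-1.
Proof.
by move=> hx; apply: cvgV; [exact: qpoch_oo_neq0|exact: cvg_qpoch].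
Qed.

Lemma cvg_qpoch_ooX p x k : normc p < 1 ->
  (fun N => qpoch_oo (x * q ^+ (N + k)) p) @ \oo --> (1 : R[i]).
Proof.
move=> p1; apply: cvg_qpoch_oo0 => //.
by apply: (cvg_shiftC (fun N => x * q ^+ N)); exact: cvg_expq.
Qed.

Lemma is_cvg_mixed_cert c b b' : cvgn (mixed_cert c b b').
Proof.
rewrite /mixed_cert.
have oo_cvg p x k : normc p < 1 -> (fun N => qpoch_oo (x * q ^+ (k + N)) p) @ \oo --> (1 : R[i]).
  by move=> p1; under eq_fun do rewrite addnC; exact: cvg_qpoch_ooX.
have alt_cvg x : (fun N => qpoch_alt x N.+2) @ \oo --> qpoch_oo x q.
  under eq_fun do rewrite -addn2.
  by apply: cvg_shiftC; exact: cvg_qpoch_alt.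
have lin_cvg x : (fun N => 1 - x * q ^+ N) @ \oo --> (1 - 0 : R[i]).
  by apply: cvgBC; [exact: cvg_cst|exact: cvg_expq].
apply: is_cvgC.
apply: cvgMC; [apply: cvgMC; [apply: cvgMC; [apply: cvgMC;
  [apply: cvgMC; [apply: cvgMC; [apply: cvgMC|]|]|]|]|]|].
- exact: cvg_qpoch.
- exact: cvg_qpoch.
- by apply: cvg_qpoch_inv => j; exact: qfactor_neq0.
- exact: (oo_cvg _ _ 1%N).
- exact: (oo_cvg _ _ 2%N).
- exact: (oo_cvg _ _ 2%N).
- by apply: cvgMC; exact: alt_cvg.
- apply: cvgMC; first exact: cvg_cst.
  apply: cvgBC; first exact: cvg_expq.
  by apply: cvgMC; exact: lin_cvg.
Qed.

(** Uniformity in [c1] serves the limit [c -> 0]; uniformity in [b1] and [b1'] serves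
    the double series, where they are [b q^n] and [b' q^n]. *)
Lemma mixed_term_le c b b' : exists2 K : R, 0 <= K &
  forall c1 b1 b1', normc c1 <= normc c -> normc b1 <= normc b -> normc b1' <= normc b' ->
  forall N, normc (mixed_term c1 b1 b1' N) <= geometric K (normc q) N.
Proof.
have [Kq Kq0 Kqle] := qpoch_q_lower.
pose A := b * b' * c ^+ 2.
pose K := (1 + normc A) * qpoch_bound q A * qpoch_bound q c * Kq
  * qpoch_bound q (b * b' * (c * q)) * qpoch_bound (q ^+ 2) (b * (c * q) ^+ 2)
  * qpoch_bound (q ^+ 2) (b' * (c * q) ^+ 2)
  * (qpoch_bound q b * qpoch_bound (q ^+ 2) b
     * (qpoch_bound q b' * qpoch_bound (q ^+ 2) b')).
exists K => [|c1 b1 b1' c1_le b1_le b1'_le N].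
  by rewrite /K !mulr_ge0 ?qpoch_bound_ge0 ?addr_ge0 ?normc_ge0.
have mono (x x' y y' : R[i]) : normc x <= normc x' -> normc y <= normc y' ->
    normc (x * y) <= normc (x' * y').
  by move=> xx' yy'; rewrite (normcM x'); exact: normcM_le.
have sqr_mono (x y : R[i]) : normc x <= normc y -> normc (x ^+ 2) <= normc (y ^+ 2).
  by move=> xy; rewrite !expr2; exact: (mono).
have cq_le : normc (c1 * q) <= normc (c * q) by apply: (mono).
have shrinkA : normc (b1 * b1' * c1 ^+ 2) <= normc A.
  by apply: (mono); [exact: (mono)|exact: (sqr_mono)].
have shrinkc2 d d' : normc d <= normc d' ->
    normc (d * (c1 * q) ^+ 2 * q ^+ N) <= normc (d' * (c * q) ^+ 2).
  move=> dd'; apply: le_trans (normcXq_le q _ N q1) _.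
  by apply: (mono) => //; exact: (sqr_mono).
have shrinkc1 : normc (b1 * b1' * (c1 * q) * q ^+ N) <= normc (b * b' * (c * q)).
  apply: le_trans (normcXq_le q _ N q1) _.
  by apply: (mono) => //; exact: (mono).
have alt_le x y : normc x <= normc y ->
    normc (qpoch_alt x N) <= qpoch_bound q y * qpoch_bound (q ^+ 2) y.
  move=> xy; apply: le_trans (normc_qpoch_alt_le _ _) _.
  by rewrite ler_pM ?qpoch_bound_ge0// qpoch_bound_le.
have oo_le p x y : normc p < 1 -> normc x <= normc y ->
    normc (qpoch_oo x p) <= qpoch_bound p y.
  by move=> p1 xy; apply: le_trans (normc_qpoch_oo_le _ _ p1) (qpoch_bound_le _ _ _ p1 xy).
have fin_le x y : normc x <= normc y -> normc (qpoch x q N) <= qpoch_bound q y.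
  by move=> xy; apply: le_trans (normc_qpoch_le _ _ _ q1) (qpoch_bound_le _ _ _ q1 xy).
have A_le : normc (1 - b1 * b1' * c1 ^+ 2 * (q ^+ N * q ^+ N)) <= 1 + normc A.
  rewrite (le_trans (ler_normcD _ _))// normc1 normcN lerD2l -exprD.
  exact: le_trans (normcXq_le q _ _ q1) shrinkA.
have -> : geometric K (normc q) N = normc q ^+ N * (1 + normc A) * qpoch_bound q A
    * qpoch_bound q c * Kq
    * qpoch_bound q (b * b' * (c * q)) * qpoch_bound (q ^+ 2) (b * (c * q) ^+ 2)
    * qpoch_bound (q ^+ 2) (b' * (c * q) ^+ 2)
    * (qpoch_bound q b * qpoch_bound (q ^+ 2) b
       * (qpoch_bound q b' * qpoch_bound (q ^+ 2) b')).
  by rewrite /geometric /K /=; ring.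
rewrite /mixed_term; apply: normcM_le; last by apply: normcM_le; exact: alt_le.
apply: normcM_le; last by apply: oo_le => //; exact: shrinkc2.
apply: normcM_le; last by apply: oo_le => //; exact: shrinkc2.
apply: normcM_le; last by apply: oo_le => //; exact: shrinkc1.
apply: normcM_le; last exact: Kqle.
apply: normcM_le; last exact: fin_le.
apply: normcM_le; last exact: fin_le.
by apply: normcM_le => //; rewrite normcX normcN.
Qed.

(** The limit of [mixed_term c b b'] as [c] tends to 0. *)
Definition mixed_term0 b b' N :=
  (- q) ^+ N / qpoch q q N * (qpoch_alt b N * qpoch_alt b' N).

Lemma mixed_term0_le b b' : exists2 K : R, 0 <= K &
  forall m N, normc (mixed_term0 (b * (q ^+ 2) ^+ m) b' N) <= geometric K (normc q) N.
Proof.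
have [Kq Kq0 Kqle] := qpoch_q_lower.
pose K := Kq * (qpoch_bound q b * qpoch_bound (q ^+ 2) b
     * (qpoch_bound q b' * qpoch_bound (q ^+ 2) b')).
exists K => [|m N]; first by rewrite /K !mulr_ge0 ?qpoch_bound_ge0.
have -> : geometric K (normc q) N = normc q ^+ N * Kq
    * (qpoch_bound q b * qpoch_bound (q ^+ 2) b
       * (qpoch_bound q b' * qpoch_bound (q ^+ 2) b')).
  by rewrite /geometric /K /=; ring.
have shrink : normc (b * (q ^+ 2) ^+ m) <= normc b by exact: normcXq_le.
rewrite /mixed_term0; apply: normcM_le; last first.
  apply: normcM_le; last exact: normc_qpoch_alt_le.
  apply: le_trans (normc_qpoch_alt_le _ _) _.
  by rewrite ler_pM ?qpoch_bound_ge0// qpoch_bound_le.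
by apply: normcM_le => //; rewrite normcX normcN.
Qed.

Definition mixed_sum0 b b' := limn (series (mixed_term0 b b')).

Lemma is_cvg_mixed c b b' : cvgn (series (mixed_term c b b')).
Proof.
have [K K0 Kle] := mixed_term_le c b b'.
apply: (dominated_series_cvg _ (geometric K (normc q))) (cvgn_geometric _ _ q1).
exact: Kle.
Qed.

Lemma is_cvg_mixed0 b b' : cvgn (series (mixed_term0 b b')).
Proof.
have [K K0 Kle] := mixed_term0_le b b'.
apply: (dominated_series_cvg _ (geometric K (normc q))) (cvgn_geometric _ _ q1).
by move=> N; have := Kle 0 N; rewrite expr0 mulr1.
Qed.

Lemma series_lincomb (s t : nat -> R[i]) (r : R[i]) : cvgn (series s) -> cvgn (series t) ->
  series (fun N => s N - r * t N) @ \oo --> (0 : R[i]) ->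
  limn (series s) = r * limn (series t).
Proof.
move=> cs ct st0; apply/eqP; rewrite -subr_eq0; apply/eqP.
apply: (cvg_uniqueC (series (fun N => s N - r * t N))) st0.
have -> : series (fun N => s N - r * t N) = (fun n => series s n - r * series t n).
  by apply/funext => n; rewrite /series /= sumrB mulr_sumr.
apply: cvgBC; first exact: cs.
by apply: cvgMC; [exact: cvg_cst|exact: ct].
Qed.

(** A contiguous relation: by [mixed_certSS] the two sides differ by a series that
    telescopes to 0. *)
Lemma mixed_sum_step c b b' : 1 - c * q != 0 ->
  mixed_sum c b b' = mixed_factor c b b' * mixed_sum (c * q) b b'.
Proof.
move=> cq; apply: series_lincomb; [exact: is_cvg_mixed|exact: is_cvg_mixed|].
have /cvg_ex[/= l cl] := is_cvg_mixed_cert c b b'.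
apply: (two_step_telescope _ _ _ _ _ _ cl).
- exact: mixed_cert0.
- exact: mixed_cert1.
- by move=> N; exact: mixed_certSS.
Qed.

Lemma mixed_sum_iter c b b' m : (forall j : nat, 1 - c * q * q ^+ j != 0) ->
  mixed_sum c b b' =
  qpoch (b * (c * q)) q m * qpoch (b' * (c * q)) q m * qpoch (- (c * q)) q m
  * qpoch (b * b' * c ^+ 2) (q ^+ 2) m * mixed_sum (c * q ^+ m) b b'.
Proof.
move=> cq; elim: m => [|m ->]; first by rewrite !qpoch0 !mul1r expr0 mulr1.
rewrite (mixed_sum_step (c * q ^+ m)); last by rewrite mulrAC.
rewrite !qpochS /mixed_factor (exprSr q m) (mulrA c).
have -> : b * b' * (c * q ^+ m) ^+ 2 = b * b' * c ^+ 2 * (q ^+ 2) ^+ m.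
  by rewrite (exprAC q 2 m); ring.
by ring.
Qed.

Lemma cvg_mixed_sum c b b' :
  (fun m => mixed_sum (c * q ^+ m) b b') @ \oo --> mixed_sum0 b b'.
Proof.
have [K K0 Kle] := mixed_term_le c b b'.
have Kle_m m := Kle (c * q ^+ m) b b' (normcXq_le q c m q1) (lexx _) (lexx _).
apply: (tannery _ _ _ Kle_m (cvgn_geometric _ _ q1)) => N.
have c0 : (fun m => c * q ^+ m) @ \oo --> (0 : R[i]) by exact: cvg_expq.
have scaled0 (u : nat -> R[i]) x : u @ \oo --> (0 : R[i]) ->
    (fun m => u m * x) @ \oo --> (0 : R[i]).
  by move=> u0; rewrite -(mul0r x); apply: cvgMC; [exact: u0|exact: cvg_cst].
have cst0 (u : nat -> R[i]) x : u @ \oo --> (0 : R[i]) ->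
    (fun m => x * u m) @ \oo --> (0 : R[i]).
  by move=> u0; rewrite -(mulr0 x); apply: cvgMC; [exact: cvg_cst|exact: u0].
have sqr0 (u : nat -> R[i]) : u @ \oo --> (0 : R[i]) ->
    (fun m => u m ^+ 2) @ \oo --> (0 : R[i]).
  by move=> u0; rewrite -(mulr0 0); exact: cvgMC.
have A0 := cst0 _ (b * b') (sqr0 _ c0).
have u0 := scaled0 _ q c0.
have -> : mixed_term0 b b' N = (- q) ^+ N * (1 - 0) * 1 * 1 / qpoch q q N * 1 * 1 * 1
    * (qpoch_alt b N * qpoch_alt b' N).
  by rewrite /mixed_term0 subr0 !mulr1.
rewrite /mixed_term.
apply: cvgMC; last exact: cvg_cst.
apply: cvgMC; last by apply: cvg_qpoch_oo0 => //; exact/scaled0/cst0/sqr0.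
apply: cvgMC; last by apply: cvg_qpoch_oo0 => //; exact/scaled0/cst0/sqr0.
apply: cvgMC; last by apply: cvg_qpoch_oo0 => //; exact/scaled0/cst0.
apply: cvgMC; last exact: cvg_cst.
apply: cvgMC; last exact: cvg_qpoch0.
apply: cvgMC; last exact: cvg_qpoch0.
apply: cvgMC; first exact: cvg_cst.
by apply: cvgBC; [exact: cvg_cst|exact: scaled0].
Qed.



(** The two-step certificate of the relation between [b] and [b q^2]. *)
Let mixed_cert_b b b' N :=
  - (b * q) * (qpoch (b * q * q) q N / qpoch q q N)
  * qpoch_oo (b * q ^+ N.+3) (q ^+ 2) * qpoch_alt b' N.+2.

Lemma is_cvg_mixed_cert_b b b' : cvgn (mixed_cert_b b b').
Proof.
apply: is_cvgC.
apply: cvgMC; last first.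
  by under eq_fun do rewrite -addn2; apply: cvg_shiftC; exact: cvg_qpoch_alt.
apply: cvgMC; last first.
  by under eq_fun do rewrite -addn3; exact: cvg_qpoch_ooX.
apply: cvgMC; first exact: cvg_cst.
by apply: cvgMC; [exact: cvg_qpoch|apply: cvg_qpoch_inv => j; exact: qfactor_neq0].
Qed.

Lemma mixed_sum0_step b b' :
  mixed_sum0 b b' = (1 - b * b' * q) * mixed_sum0 (b * q ^+ 2) b'.
Proof.
apply: series_lincomb; [exact: is_cvg_mixed0|exact: is_cvg_mixed0|].
have /cvg_ex[/= l cl] := is_cvg_mixed_cert_b b b'.
apply: (two_step_telescope _ _ _ _ _ _ cl).
- rewrite /mixed_term0 /mixed_cert_b qpoch_altSS /qpoch_alt !qpoch0 !expr0.
  rewrite (qpoch_oo_step _ (b * q ^+ 1) q21).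
  have -> : b * q ^+ 1 * q ^+ 2 = b * q ^+ 3 by ring.
  have -> : b * q ^+ 2 * q ^+ 1 = b * q ^+ 3 by ring.
  by field.
- rewrite /mixed_term0 /mixed_cert_b qpoch_altSS /qpoch_alt !qpochS !qpoch0 !expr0 !expr1.
  rewrite (qpoch_oo_step _ (b * q ^+ 2) q21).
  have -> : b * q ^+ 2 * q ^+ 2 = b * q ^+ 4 by ring.
  set O1 := qpoch_oo (b * q ^+ 4) _; set O2 := qpoch_oo (b' * _) _.
  have := qfactor_neq0 0; rewrite expr0 mulr1 => n1; clearbody O1 O2.
  by field.
move=> N; rewrite /mixed_term0 /mixed_cert_b (qpoch_altSS b' N.+2).
rewrite /(qpoch_alt b) /(qpoch_alt (b * _)).
rewrite (qpochSl b q N.+1) (qpochSl (b * q) q N).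
have -> : b * q ^+ 2 = b * q * q by ring.
rewrite !(qpochS _ q N.+1) !(qpochS _ q N).
rewrite (qpoch_oo_step _ (b * q ^+ N.+3) q21).
set x := q ^+ N.
rewrite !(exprS q N.+4) !(exprS q N.+3) !(exprS q N.+2) !(exprS q N.+1) !(exprS q N) -/x.
have -> : b * (q * (q * (q * x))) * q ^+ 2 = b * (q * (q * (q * (q * (q * x))))) by ring.
have -> : b * q * q * (q * (q * (q * x))) = b * (q * (q * (q * (q * (q * x))))) by ring.
rewrite !(exprS (- q) N.+1) !(exprS (- q) N).
have -> : (- q) ^+ N = (-1) ^+ N * x by exact: (exprNn q N).
have n1 := qfactor_neq0 N; have n2 := qfactor_neq0 N.+1; have n3 := qpoch_neq0 _ _ N qfactor_neq0.
rewrite exprS -/x in n2; rewrite -/x in n1.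
set O1 := qpoch_oo _ _; set H2 := qpoch_alt b' _.
move: n3; set P1 := qpoch q q N; set P2 := qpoch _ q N => n3.
set sgn := (-1) ^+ N.
clear cl; clearbody O1 H2 P1 P2 sgn x.
by field; rewrite n1 n2 n3.
Qed.

Lemma mixed_sum0_iter b b' m :
  mixed_sum0 b b' =
  qpoch (b * b' * q) (q ^+ 2) m * mixed_sum0 (b * (q ^+ 2) ^+ m) b'.
Proof.
elim: m => [|m ->]; first by rewrite qpoch0 expr0 mul1r mulr1.
rewrite mixed_sum0_step qpochS (exprSr (q ^+ 2) m) (mulrA b).
by ring.
Qed.

(** Iterating the step sends [b] to 0.  By symmetry [b'] can be sent to 0 in the same
    way, at no cost once [b = 0]. *)
Lemma mixed_sum0_reduce b b' :
  mixed_sum0 b b' = qpoch_oo (b * b' * q) (q ^+ 2) * mixed_sum0 0 b'.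
Proof.
apply: (cvg_uniqueC (cst (mixed_sum0 b b'))); first exact: cvg_cst.
have -> : cst (mixed_sum0 b b') = (fun m => qpoch (b * b' * q) (q ^+ 2) m *
    mixed_sum0 (b * (q ^+ 2) ^+ m) b').
  by apply/funext => m; exact: mixed_sum0_iter.
apply: cvgMC; first exact: cvg_qpoch.
have [K K0 Kle] := mixed_term0_le b b'.
apply: (tannery _ _ _ Kle (cvgn_geometric _ _ q1)) => N.
have b0 : (fun m => b * (q ^+ 2) ^+ m) @ \oo --> (0 : R[i]) by exact: cvg_expq.
rewrite /mixed_term0; apply: cvgMC; first exact: cvg_cst.
apply: cvgMC; last exact: cvg_cst.
have -> : qpoch_alt 0 N = 1 * 1.
  rewrite /qpoch_alt mul0r; congr (_ * _).
    by apply: (cvg_uniqueC (fun=> qpoch 0 q N)); [exact: cvg_cst|apply: cvg_qpoch0 => //; exact: cvg_cst].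
  by apply: (cvg_uniqueC (fun=> qpoch_oo 0 (q ^+ 2))); [exact: cvg_cst|apply: cvg_qpoch_oo0 => //; exact: cvg_cst].
apply: cvgMC; first exact: cvg_qpoch0.
apply: cvg_qpoch_oo0 => //; rewrite -(mul0r (q ^+ N.+1)).
by apply: cvgMC; [exact: b0|exact: cvg_cst].
Qed.

Lemma mixed_sum0C b b' : mixed_sum0 b b' = mixed_sum0 b' b.
Proof.
rewrite /mixed_sum0; suff -> : mixed_term0 b b' = mixed_term0 b' b by [].
by apply/funext => N; rewrite /mixed_term0; congr (_ * _); exact: mulrC.
Qed.

Lemma qpoch_oo0 (p : R[i]) : normc p < 1 -> qpoch_oo 0 p = 1.
Proof.
move=> p1; apply: (cvg_uniqueC (fun=> qpoch_oo 0 p)); first exact: cvg_cst.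
by apply: cvg_qpoch_oo0 => //; exact: cvg_cst.
Qed.

Lemma mixed_sum_closed0 c b b' : (forall j : nat, 1 - c * q * q ^+ j != 0) ->
  mixed_sum c b b' =
  qpoch_oo (b * (c * q)) q * qpoch_oo (b' * (c * q)) q * qpoch_oo (- (c * q)) q
  * qpoch_oo (b * b' * c ^+ 2) (q ^+ 2) * mixed_sum0 b b'.
Proof.
move=> cq; apply: (cvg_uniqueC (cst (mixed_sum c b b'))); first exact: cvg_cst.
have -> : cst (mixed_sum c b b') = (fun m => qpoch (b * (c * q)) q m
    * qpoch (b' * (c * q)) q m * qpoch (- (c * q)) q m
    * qpoch (b * b' * c ^+ 2) (q ^+ 2) m * mixed_sum (c * q ^+ m) b b').
  by apply/funext => m; exact: mixed_sum_iter.
apply: cvgMC; last exact: cvg_mixed_sum.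
by do 3?[apply: cvgMC]; exact: cvg_qpoch.
Qed.

(** At [c = 1] the series stops after its first term. *)
Lemma mixed_sum1 : mixed_sum 1 0 0 = 1.
Proof.
apply: limn_eq; rewrite -(cvg_shiftn 1) /=.
have -> : (fun n => series (mixed_term 1 0 0) (n + 1)%N) = cst (1 : R[i]).
  apply/funext => n; rewrite addn1; elim: n => [|n IH].
    rewrite seriesSr /series /= big_geq// add0r /mixed_term /qpoch_alt !qpoch0.
    by rewrite !(mul0r, mulr0, subr0, expr0, mulr1, mul1r) !qpoch_oo0// invr1 !mulr1.
  rewrite seriesSr IH /mixed_term (qpochSl 1) subrr !(mul0r, mulr0).
  by rewrite addr0.
exact: cvg_cst.
Qed.

(** The value at [c = 1] gives the inverse of [(-q; q)_oo], which equals
    [(q; q^2)_oo] by Euler's identity. *)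
Lemma mixed_sum00 : mixed_sum0 0 0 = qpoch_oo q (q ^+ 2).
Proof.
have := mixed_sum_closed0 1 0 0.
rewrite mixed_sum1 mul1r => /(_ qfactor_neq0); rewrite !mul0r !qpoch_oo0// !mul1r mulr1 => e1.
have qq : qpoch_oo (q ^+ 2) (q ^+ 2) != 0.
  apply: qpoch_oo_neq0 => // j; have := qfactor_neq0 (j + j).+1.
  by rewrite -!exprM mul2n -addnn -!exprS -exprD.
have e2 := qpoch_oo_sqr q q q1.
have e3 := qpoch_oo_dissect q q q1; rewrite -expr2 in e3.
have n0 : qpoch_oo (- q) q != 0.
  by apply: contra_eqN e1 => /eqP ->; rewrite mul0r oner_eq0.
have solve (P P' Q X M : R[i]) : 1 = P' * M -> Q = P * P' -> P = X * Q -> Q != 0 ->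
    P' != 0 -> M = X.
  move=> eM eQ eP Q0 P'0; apply: (mulfI P'0); rewrite -eM; apply: (mulIf Q0).
  by rewrite mul1r {1}eQ eP; ring.
exact: (solve _ _ _ _ _ e1 e2 e3 qq n0).
Qed.

Lemma mixed_sum0_left0 b' : mixed_sum0 0 b' = qpoch_oo q (q ^+ 2).
Proof.
by rewrite mixed_sum0C mixed_sum0_reduce mulr0 mul0r (qpoch_oo0 _ q21) mul1r mixed_sum00.
Qed.

(** A case of Bailey's nonterminating form of Jackson's sum. *)
Lemma mixed_sum_closed c b b' : (forall j : nat, 1 - c * q * q ^+ j != 0) ->
  mixed_sum c b b' =
  qpoch_oo (b * (c * q)) q * qpoch_oo (b' * (c * q)) q * qpoch_oo (- (c * q)) q
  * qpoch_oo (b * b' * c ^+ 2) (q ^+ 2) * qpoch_oo (b * b' * q) (q ^+ 2)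
  * qpoch_oo q (q ^+ 2).
Proof.
move=> cq; by rewrite (mixed_sum_closed0 _ _ _ cq) (mixed_sum0_reduce b) mixed_sum0_left0 mulrA.
Qed.

End MixedBaseSum.

(** * Exchanging the order of summation *)

Section WPBaileyTransform.
Context {R : realType}.
Variables (q k c y z b b' : R[i]).
Hypothesis q1 : normc q < 1.
Let a := c * k.
Let w := c ^+ 2 * k * q / (y * z).
Let al := b * b'.
Hypotheses (c0 : c != 0) (k0 : k != 0) (q0 : q != 0) (y0 : y != 0) (z0 : z != 0).
Hypothesis bbc : b * b' * c = k.
Hypothesis k1 : 1 - k != 0.
Hypothesis kqN : forall j : nat, 1 - k * q * q ^+ j != 0.
Hypothesis cqN : forall j : nat, 1 - c * q * q ^+ j != 0.
Hypothesis yN : forall j : nat, 1 - a * q / y * q ^+ j != 0.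
Hypothesis zN : forall j : nat, 1 - a * q / z * q ^+ j != 0.
Hypothesis wN : forall j : nat, 1 - a * q / w * q ^+ j != 0.
Hypothesis bN : forall j : nat, 1 - b * (c * q) * q ^+ j != 0.
Hypothesis b'N : forall j : nat, 1 - b' * (c * q) * q ^+ j != 0.
Hypothesis alN : forall j : nat, 1 - al * q * (q ^+ 2) ^+ j != 0.

Let q21 : normc (q ^+ 2) < 1 := normc_sqr_lt1 _ q1.
Let qqN j : 1 - q * q ^+ j != 0 := qfactor_neq0 q q1 j.

(** The terms of the series on the left ([vwp_term_beta]). *)
Definition beta_summand n : R[i] :=
  (- q) ^+ n * wp_beta q k c y z n * (qpoch b q n * qpoch b' q n)
  * qpoch (a * q) (q ^+ 2) n
  / (qpoch (b * (c * q)) q n * qpoch (b' * (c * q)) q n * qpoch (al * q) (q ^+ 2) n).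

(** The terms of the two series on the right, merged into one of base [q]
    ([vwp_term_alpha_even], [vwp_term_alpha_odd]). *)
Definition alpha_summand N : R[i] :=
  (- q) ^+ N * (1 - a * (q ^+ N * q ^+ N)) * wp_alpha q k c y z N
  * (qpoch_oo (b * (c * q) ^+ 2 * q ^+ N) (q ^+ 2)
     * qpoch_oo (b' * (c * q) ^+ 2 * q ^+ N) (q ^+ 2))
  * (qpoch_alt q b N * qpoch_alt q b' N).

Let pair_summand n r : R[i] :=
  beta_summand n
  * (qpoch (b * (c * q)) q n * qpoch (b' * (c * q)) q n * qpoch (al * q) (q ^+ 2) n
     * qpoch a (q ^+ 2) n / qpoch_oo (k * q) q)
  * mixed_term q c (b * q ^+ n) (b' * q ^+ n) r.

(** All parameters of the sum over [r] are those of [mixed_term] with [b] and [b']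
    multiplied by [q^n] and the same [c]; this works because [b b' c = k]. *)
Lemma pair_summandE n r (N := (n + r)%N) :
  (- q) ^+ N * (1 - a * (q ^+ N * q ^+ N))
  * (wp_beta q k c y z n * wp_kernel q k c (N + n) r)
  * (qpoch_oo (b * (c * q) ^+ 2 * q ^+ N) (q ^+ 2)
     * qpoch_oo (b' * (c * q) ^+ 2 * q ^+ N) (q ^+ 2))
  * (qpoch_alt q b N * qpoch_alt q b' N) = pair_summand n r.
Proof.
rewrite /N.
rewrite /pair_summand /beta_summand /mixed_term /wp_kernel.
rewrite !qpoch_altD -(addnA n r n) (addnC r n) addnA !(qpochD _ _ (n + n) r).
have -> : b * q ^+ n * (b' * q ^+ n) * c ^+ 2 = a * q ^+ (n + n).
  by rewrite /a -bbc exprD; ring.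
have -> : b * q ^+ n * (b' * q ^+ n) * (c * q) * q ^+ r = k * q * q ^+ (n + n + r).
  by rewrite -bbc !exprD; ring.
have alg d : d * q ^+ n * (c * q) ^+ 2 * q ^+ r = d * (c * q) ^+ 2 * q ^+ (n + r).
  by rewrite exprD; ring.
rewrite !alg (qpoch_ooD q (k * q) (n + n + r) q1) (qpochD _ _ (n + n) r).
rewrite (qpoch_dissect a q n) !exprD.
have := (qpoch_neq0 _ _ n bN, qpoch_neq0 _ _ n b'N, qpoch_neq0 _ _ n alN,
  qpoch_neq0 _ _ r qqN, qpoch_neq0 _ _ (n + n) kqN).
case=> -[[[n1 n2] n3] n4] n5.
have kqN2 j : 1 - k * q * q ^+ (n + n) * q ^+ j != 0.
  by rewrite -(mulrA _ (q ^+ _)) -exprD.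
have n6 := qpoch_neq0 _ _ r kqN2.
have n7 : qpoch_oo (k * q * q ^+ (n + n + r)) q != 0.
  by apply: qpoch_oo_neq0 => // j; rewrite -(mulrA _ (q ^+ _)) -exprD.
rewrite !exprD in n6 n7 *.
move: (qpoch (b * (c * q)) q n) n1 (qpoch (b' * (c * q)) q n) n2 => P1 n1 P2 n2.
move: (qpoch (al * q) _ n) n3 (qpoch q q r) n4 => P3 n3 P4 n4.
move: (qpoch (k * q) q (n + n)) n5 (qpoch (k * q * _) q r) n6 => P5 n5 P6 n6.
move: (qpoch_oo (k * q * _) q) n7 => P7 n7.
move: (wp_beta _ _ _ _ _ _) (qpoch a _ n) (qpoch (a * q) _ n) (qpoch (a * _) q r) => B Q1 Q2 Q3.
move: (qpoch b q n) (qpoch b' q n) (qpoch c q r) => Q4 Q5 Q6.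
move: (qpoch_alt _ _ _) (qpoch_alt _ _ _) (qpoch_oo _ _) (qpoch_oo _ _) => H1 H2 O1 O2.
by field; rewrite n1 n2 n3 n4 n5 n6 n7.
Qed.


Lemma alpha_summand_split N :
  alpha_summand N = \sum_(n < N.+1) pair_summand n (N - n)%N.
Proof.
rewrite /alpha_summand -(jackson_sum q k c y z c0 k0 q0 y0 z0 k1 qqN kqN yN zN wN N).
rewrite mulr_sumr !mulr_suml; apply: eq_bigr => n _.
have nN : (n <= N)%N by rewrite -ltnS.
by rewrite -pair_summandE subnKC.
Qed.


Definition transform_constant : R[i] :=
  qpoch_oo (b * (c * q)) q * qpoch_oo (b' * (c * q)) q * qpoch_oo (- (c * q)) q
  * qpoch_oo a (q ^+ 2) * qpoch_oo (al * q) (q ^+ 2) * qpoch_oo q (q ^+ 2)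
  / qpoch_oo (k * q) q.

Lemma series_pair_summand n :
  limn (series (pair_summand n)) = beta_summand n * transform_constant.
Proof.
rewrite /pair_summand; set d := _ * (_ / _).
have -> : series (fun r => d * mixed_term q c (b * q ^+ n) (b' * q ^+ n) r) =
    (fun m => d * series (mixed_term q c (b * q ^+ n) (b' * q ^+ n)) m).
  by apply/funext => m; rewrite /series /= mulr_sumr.
rewrite (limn_eq _ (d * mixed_sum q c (b * q ^+ n) (b' * q ^+ n))); last first.
  by apply: cvgMC; [exact: cvg_cst|exact: is_cvg_mixed].
rewrite mixed_sum_closed// /d /transform_constant.
move: (beta_summand n) => B.
rewrite (qpoch_ooD q (b * (c * q)) n q1) (qpoch_ooD q (b' * (c * q)) n q1).
rewrite (qpoch_ooD _ a n q21) (qpoch_ooD _ (al * q) n q21).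
have -> : b * q ^+ n * (c * q) = b * (c * q) * q ^+ n by ring.
have -> : b' * q ^+ n * (c * q) = b' * (c * q) * q ^+ n by ring.
have -> : b * q ^+ n * (b' * q ^+ n) * c ^+ 2 = a * (q ^+ 2) ^+ n.
  by rewrite /a -bbc (exprAC q 2 n); ring.
have -> : b * q ^+ n * (b' * q ^+ n) * q = al * q * (q ^+ 2) ^+ n.
  by rewrite /al (exprAC q 2 n); ring.
move: (qpoch (b * (c * q)) q n) (qpoch (b' * (c * q)) q n) => P1 P2.
move: (qpoch (al * q) _ n) (qpoch a _ n) (qpoch_oo (k * q) q) => P3 P4 P5.
move: (qpoch_oo (b * (c * q) * _) q) (qpoch_oo (b' * (c * q) * _) q) => O1 O2.
move: (qpoch_oo (- (c * q)) q) (qpoch_oo (a * _) _) (qpoch_oo (al * q * _) _) => O3 O4 O5.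
move: (qpoch_oo q _) => O6.
by ring.
Qed.

Lemma pair_summand_le : exists2 K : R, 0 <= K & forall n r,
  normc (pair_summand n r) <= normc (beta_summand n) * K * normc q ^+ r.
Proof.
have [Km Km0 Kmle] := mixed_term_le q q1 c b b'.
pose K := qpoch_bound q (b * (c * q)) * qpoch_bound q (b' * (c * q))
  * qpoch_bound (q ^+ 2) (al * q) * qpoch_bound (q ^+ 2) a
  * normc (qpoch_oo (k * q) q)^-1.
exists (K * Km) => [|n r].
  by rewrite /K !mulr_ge0 ?qpoch_bound_ge0 ?normc_ge0.
rewrite mulrA -(mulrA _ Km); apply: normcM_le; last first.
  by apply: Kmle => //; exact: normcXq_le.
by apply: normcM_le => //; do 4?[apply: normcM_le => //]; exact: normc_qpoch_le.
Qed.

(** The double series obtained from Jackson's sum is dominated by the one over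
    [beta_summand] itself, so the summations may be exchanged even when [c] is
    large and that series converges only because it terminates. *)
Lemma wp_bailey_transform : cvgn (series (@normc R \o beta_summand)) ->
  series alpha_summand @ \oo --> transform_constant * limn (series beta_summand).
Proof.
move=> cbeta; have [K K0 Kle] := pair_summand_le.
have cM : cvgn (series (fun n => normc (beta_summand n) * K)).
  rewrite (_ : (fun n => _) = K *: (@normc R \o beta_summand)).
    exact: is_cvg_seriesZ.
  by apply/funext => n; rewrite /= mulrC.
have rho1 : 0 <= normc q < 1 by rewrite normc_ge0.
have := triangular_double_series pair_summand _ _ rho1 cM Kle.
have -> : (fun N => \sum_(n < N.+1) pair_summand n (N - n)%N) = alpha_summand.
  by apply/funext => N; rewrite alpha_summand_split.
have -> : (fun n => limn (series (pair_summand n))) =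
    (fun n => transform_constant * beta_summand n).
  by apply/funext => n; rewrite series_pair_summand mulrC.
suff -> : limn (series (fun n => transform_constant * beta_summand n)) =
    transform_constant * limn (series beta_summand) by [].
apply: limn_eq.
have -> : series (fun n => transform_constant * beta_summand n) =
    (fun m => transform_constant * series beta_summand m).
  by apply/funext => m; rewrite /series /= mulr_sumr.
apply: cvgMC; first exact: cvg_cst.
exact: (dominated_series_cvg _ _ (fun n => lexx _) cbeta).
Qed.

End WPBaileyTransform.

(** * The three very-well-poised series *)

Section VeryWellPoised.
Context {C : numClosedFieldType}.
Implicit Types (p a x s : C) (l : seq C).

Lemma qpochs_cons p x l n : qpochs (x :: l) p n = qpoch x p n * qpochs l p n.
Proof. exact: big_cons. Qed.

Lemma qpochs_nil p n : qpochs [::] p n = 1 :> C.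
Proof. exact: big_nil. Qed.

Lemma qpochs_oo_cons2 p x s l :
  qpochs_oo [:: x, s & l] p = qpoch_oo x p * qpochs_oo (s :: l) p.
Proof. exact: big_cons. Qed.

Lemma qpochs_oo_seq1 p x : qpochs_oo [:: x] p = qpoch_oo x p.
Proof. exact: big_seq1. Qed.

(** The square roots disappear: [(p s; p)_n / (s; p)_n = (1 - s p^n) / (1 - s)], taken
    at [s] and [- s] with [s^2 = a]. *)
Lemma vwp_termE p a l x n : nonzero_factors (vwp_den p a l) p ->
  vwp_term p a l x n =
  (1 - a * (p ^+ n * p ^+ n)) / (1 - a) * (qpoch a p n / qpoch p p n)
  * (qpochs l p n / qpochs [seq a * p / c | c <- l] p n) * x ^+ n.
Proof.
rewrite /nonzero_factors /vwp_term /vwp_num /vwp_den => nz.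
have mem d : d \in [:: p; sqrtC a; - sqrtC a] ->
    d \in [:: p, sqrtC a, - sqrtC a & [seq a * p / c | c <- l]].
  by rewrite !inE; case/or3P => ->; rewrite ?orbT.
have /nz pN : p \in [:: p, sqrtC a, - sqrtC a & [seq a * p / c | c <- l]].
  by apply: mem; rewrite !inE eqxx.
have /nz sN : sqrtC a \in [:: p, sqrtC a, - sqrtC a & [seq a * p / c | c <- l]].
  by apply: mem; rewrite !inE eqxx orbT.
have /nz sN' : - sqrtC a \in [:: p, sqrtC a, - sqrtC a & [seq a * p / c | c <- l]].
  by apply: mem; rewrite !inE eqxx !orbT.
rewrite !qpochs_cons.
have shift s : 1 - s != 0 -> qpoch (p * s) p n = qpoch s p n * (1 - s * p ^+ n) / (1 - s).
  by move=> s1; apply: (mulfI s1); rewrite mulrCA divff// mulr1 -qpochS qpochSl (mulrC p).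
have s1 := sN 0; rewrite expr0 mulr1 in s1.
have s1' := sN' 0; rewrite expr0 mulr1 in s1'.
rewrite -mulrN !shift//.
have -> : 1 - a * (p ^+ n * p ^+ n) = (1 - sqrtC a * p ^+ n) * (1 - - sqrtC a * p ^+ n).
  by rewrite -[in LHS](sqrtCK a); ring.
have aE : 1 - a = (1 - sqrtC a) * (1 - - sqrtC a) by rewrite -[in LHS](sqrtCK a); ring.
rewrite aE.
have := (qpoch_neq0 _ _ n pN, qpoch_neq0 _ _ n sN, qpoch_neq0 _ _ n sN').
case=> -[n1 n2] n3.
rewrite invfM (invfM (qpoch (sqrtC a) p n)) (invfM (qpoch (- sqrtC a) p n)).
set D := (qpochs _ _ _)^-1; set N := qpochs _ _ _.
by field; rewrite n1 n2 n3 s1 s1'.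
Qed.

End VeryWellPoised.

Section VeryWellPoisedSummands.
Context {R : realType}.
Variables (q k c y z b b' : R[i]).
Hypothesis q1 : normc q < 1.
Let a := c * k.
Let w := c ^+ 2 * k * q / (y * z).
Hypotheses (c0 : c != 0) (k0 : k != 0) (q0 : q != 0) (y0 : y != 0) (z0 : z != 0).
Hypotheses (b0 : b != 0) (b'0 : b' != 0).
Hypothesis bbc : b * b' * c = k.
Let q21 : normc (q ^+ 2) < 1 := normc_sqr_lt1 _ q1.

Lemma nonzero_factors_qpoch (ds : seq R[i]) p d n :
  nonzero_factors ds p -> d \in ds -> qpoch d p n != 0.
Proof. by move=> nz dds; apply: qpoch_neq0; exact: nz. Qed.

Lemma qpoch_alt_even x r :
  qpoch_alt q x (r + r) = qpoch x (q ^+ 2) r * qpoch_oo (x * q) (q ^+ 2).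
Proof.
rewrite /qpoch_alt qpoch_dissect (qpoch_ooD _ (x * q) r q21) -!mulrA.
by rewrite -exprM mul2n -addnn -exprS.
Qed.

Lemma qpoch_alt_odd x r :
  qpoch_alt q x (r + r).+1 = qpoch (x * q) (q ^+ 2) r * qpoch_oo x (q ^+ 2).
Proof.
have sq : (q ^+ 2) ^+ r = q ^+ (r + r) by rewrite -exprM mul2n -addnn.
rewrite /qpoch_alt qpochS qpoch_dissect (qpoch_ooD _ x r.+1 q21) qpochS.
have -> : x * q ^+ (r + r).+2 = x * (q ^+ 2) ^+ r.+1 by rewrite (exprS (q ^+ 2)) sq !exprS; ring.
by rewrite sq; ring.
Qed.


(** The parameters [s] and [- s] combine into one symbol of base [q^2]
    ([qpoch_sqr]), in the numerator and in the denominator. *)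
Lemma vwp_term_beta n (s := sqrtC (q * a))
    (l := [:: b'; b; s; - s; y / c; z / c; w / c]) :
  nonzero_factors (vwp_den q k l) q -> 1 - k != 0 ->
  vwp_term q k l (- (q * c)) n = beta_summand q k c y z b b' n.
Proof.
move=> nz k1; rewrite vwp_termE//.
have s2 : s ^+ 2 = a * q by rewrite /s sqrtCK mulrC.
have s0 : s != 0 by rewrite -sqrf_eq0 s2 !mulf_neq0.
have nzn d : d \in vwp_den q k l -> qpoch d q n != 0 by exact: nonzero_factors_qpoch.
have w0 : w != 0 by rewrite /w !mulf_neq0 ?invr_neq0 ?mulf_neq0 ?expf_neq0.
have e1 : k * q / b' = b * (c * q) by rewrite -bbc; field.
have e2 : k * q / b = b' * (c * q) by rewrite -bbc; field.
have e3 x : x != 0 -> k * q / (x / c) = a * q / x by move=> x0; rewrite /a; field; rewrite x0 c0.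
have e4 : k * q / - s = - (k * q / s) by rewrite invrN mulrN.
have e5 : (k * q / s) ^+ 2 = b * b' * q.
  rewrite exprMn exprVn s2 /a -bbc; field.
  by rewrite q0 c0 b0 b'0.
have := (nzn q, nzn (b * (c * q)), nzn (b' * (c * q)), nzn (k * q / s),
  nzn (- (k * q / s)), nzn (a * q / y), nzn (a * q / z), nzn (a * q / w)).
rewrite /vwp_den /l /= e1 e2 e4 !e3// !inE !eqxx !orbT.
move=> [[[[[[[n1 n2] n3] n4] n5] n6] n7] n8].
have {}n1 := n1 isT; have {}n2 := n2 isT; have {}n3 := n3 isT; have {}n4 := n4 isT.
have {}n5 := n5 isT; have {}n6 := n6 isT; have {}n7 := n7 isT; have {}n8 := n8 isT.
rewrite !qpochs_cons !qpochs_nil /beta_summand /wp_beta /wp_ratio -/a -/w.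
have -> : qpoch (a * q) (q ^+ 2) n = qpoch s q n * qpoch (- s) q n.
  by rewrite -s2 qpoch_sqr.
have -> : qpoch (b * b' * q) (q ^+ 2) n = qpoch (k * q / s) q n * qpoch (- (k * q / s)) q n.
  by rewrite -e5 qpoch_sqr.
have -> : (- (q * c)) ^+ n = (- q) ^+ n * c ^+ n by rewrite -exprMn mulNr.
move: (qpoch q q n) n1 (qpoch (b * (c * q)) q n) n2 (qpoch (b' * (c * q)) q n) n3.
move=> P1 n1 P2 n2 P3 n3.
move: (qpoch (k * q / s) q n) n4 (qpoch (- (k * q / s)) q n) n5 => P4 n4 P5 n5.
move: (qpoch (a * q / y) q n) n6 (qpoch (a * q / z) q n) n7 (qpoch (a * q / w) q n) n8.
move=> P6 n6 P7 n7 P8 n8.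
set Q1 := qpoch k _ _; set Q2 := qpoch b _ _; set Q3 := qpoch b' _ _.
set Q4 := qpoch s _ _; set Q5 := qpoch (- s) _ _; set Q6 := qpoch (y / c) _ _.
set Q7 := qpoch (z / c) _ _; set Q8 := qpoch (w / c) _ _.
clearbody Q1 Q2 Q3 Q4 Q5 Q6 Q7 Q8.
by field; rewrite n1 n2 n3 n4 n5 n6 n7 n8 k1.
Qed.

Lemma wp_alpha_even r :
  wp_alpha q k c y z (r + r) =
  qpoch a (q ^+ 2) r * qpoch (a * q) (q ^+ 2) r * (qpoch y (q ^+ 2) r * qpoch (y * q) (q ^+ 2) r)
  * (qpoch z (q ^+ 2) r * qpoch (z * q) (q ^+ 2) r)
  * (qpoch w (q ^+ 2) r * qpoch (w * q) (q ^+ 2) r)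
  / (qpoch q (q ^+ 2) r * qpoch (q * q) (q ^+ 2) r
     * (qpoch (a * q / y) (q ^+ 2) r * qpoch (a * q / y * q) (q ^+ 2) r)
     * (qpoch (a * q / z) (q ^+ 2) r * qpoch (a * q / z * q) (q ^+ 2) r)
     * (qpoch (a * q / w) (q ^+ 2) r * qpoch (a * q / w * q) (q ^+ 2) r)).
Proof. by rewrite /wp_alpha !qpoch_dissect. Qed.

(** Every [(x; q)_{2r}] splits into [(x; q^2)_r (x q; q^2)_r], which is why the
    parameters come in pairs [x], [x q]; [b] and [b'] stay single because
    [qpoch_alt] progresses by steps of 2. *)
Lemma vwp_term_alpha_even r
    (l := [:: b'; b; a * q; y; y * q; z; z * q; w; w * q]) :
  nonzero_factors (vwp_den (q ^+ 2) a l) (q ^+ 2) -> 1 - a != 0 ->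
  alpha_summand q k c y z b b' (r + r) =
  (1 - a) * (qpoch_oo (b' * q) (q ^+ 2) * qpoch_oo (b * q) (q ^+ 2)
    * qpoch_oo (b * (c * q) ^+ 2) (q ^+ 2) * qpoch_oo (b' * (c * q) ^+ 2) (q ^+ 2))
  * vwp_term (q ^+ 2) a l (q ^+ 2) r.
Proof.
move=> nz a1; rewrite vwp_termE//.
have a0 : a != 0 by rewrite mulf_neq0.
have nzr d : d \in vwp_den (q ^+ 2) a l -> qpoch d (q ^+ 2) r != 0.
  exact: nonzero_factors_qpoch.
have w0 : w != 0 by rewrite /w !mulf_neq0 ?invr_neq0 ?mulf_neq0 ?expf_neq0.
have e1 : a * q ^+ 2 / b' = b * (c * q) ^+ 2 by rewrite /a -bbc; field.
have e2 : a * q ^+ 2 / b = b' * (c * q) ^+ 2 by rewrite /a -bbc; field.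
have e3 : a * q ^+ 2 / (a * q) = q by field; rewrite a0 q0.
have e4 x : a * q ^+ 2 / x = a * q / x * q by ring.
have e5 x : x != 0 -> a * q ^+ 2 / (x * q) = a * q / x.
  by move=> x0; field; rewrite x0 q0.
have := (nzr (q ^+ 2), nzr (b * (c * q) ^+ 2), nzr (b' * (c * q) ^+ 2), nzr q,
  nzr (a * q / y * q), nzr (a * q / y), nzr (a * q / z * q), nzr (a * q / z),
  nzr (a * q / w * q), nzr (a * q / w)).
rewrite /vwp_den /l /= e1 e2 e3 !e5// !(e4 y, e4 z, e4 w) !inE !eqxx !orbT.
move=> [[[[[[[[[n1 n2] n3] n4] n5] n6] n7] n8] n9] n10].
have {}n1 := n1 isT; have {}n2 := n2 isT; have {}n3 := n3 isT; have {}n4 := n4 isT.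
have {}n5 := n5 isT; have {}n6 := n6 isT; have {}n7 := n7 isT; have {}n8 := n8 isT.
have {}n9 := n9 isT; have {}n10 := n10 isT.
rewrite !qpochs_cons !qpochs_nil /alpha_summand -/a -/w wp_alpha_even.
rewrite !qpoch_alt_even.
rewrite (qpoch_ooD _ (b * (c * q) ^+ 2) r q21) (qpoch_ooD _ (b' * (c * q) ^+ 2) r q21).
have -> : (- q) ^+ (r + r) = (q ^+ 2) ^+ r by rewrite addnn -mul2n exprM sqrrN.
have -> : q ^+ (r + r) = (q ^+ 2) ^+ r by rewrite addnn -mul2n exprM.
rewrite -expr2.
move: (qpoch (q ^+ 2) _ r) n1 (qpoch (b * (c * q) ^+ 2) _ r) n2 => P1 n1 P2 n2.
move: (qpoch (b' * (c * q) ^+ 2) _ r) n3 (qpoch q _ r) n4 => P3 n3 P4 n4.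
move: (qpoch (a * q / y * q) _ r) n5 (qpoch (a * q / y) _ r) n6 => P5 n5 P6 n6.
move: (qpoch (a * q / z * q) _ r) n7 (qpoch (a * q / z) _ r) n8 => P7 n7 P8 n8.
move: (qpoch (a * q / w * q) _ r) n9 (qpoch (a * q / w) _ r) n10 => P9 n9 P10 n10.
set Q1 := qpoch a _ _; set Q2 := qpoch (a * q) _ _; set Q3 := qpoch b _ _.
set Q4 := qpoch b' _ _; set Q5 := qpoch y _ _; set Q6 := qpoch (y * q) _ _.
set Q7 := qpoch z _ _; set Q8 := qpoch (z * q) _ _; set Q9 := qpoch w _ _.
set Q10 := qpoch (w * q) _ _; set O1 := qpoch_oo (b * q) _; set O2 := qpoch_oo (b' * q) _.
set O3 := qpoch_oo (b * (c * q) ^+ 2 * _) _; set O4 := qpoch_oo (b' * (c * q) ^+ 2 * _) _.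
set x := (q ^+ 2) ^+ r.
clearbody Q1 Q2 Q3 Q4 Q5 Q6 Q7 Q8 Q9 Q10 O1 O2 O3 O4 x.
by field; rewrite n1 n2 n3 n4 n5 n6 n7 n8 n9 n10 a1.
Qed.


(** Splitting off the first factor of each [(x; q)_{2r+1}] produces the rational
    prefactor and shifts the remaining parameters by [q]. *)
Lemma vwp_term_alpha_odd r
    (l := [:: b' * q; b * q; a * q; y * q; y * q ^+ 2; z * q; z * q ^+ 2;
              w * q; w * q ^+ 2]) :
  nonzero_factors (vwp_den (q ^+ 2) (q ^+ 2 * a) l) (q ^+ 2) ->
  1 - a != 0 -> 1 - q ^+ 2 * a != 0 -> 1 - q != 0 ->
  1 - a * q / y != 0 -> 1 - a * q / z != 0 -> 1 - a * q / w != 0 ->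
  alpha_summand q k c y z b b' (r + r).+1 =
  - ((1 - a) * (q * ((1 - a * q ^+ 2) * (1 - y) * (1 - z) * (1 - w)
      / ((1 - q) * (1 - a * q / y) * (1 - a * q / z) * (1 - a * q / w))))
  * (qpoch_oo b' (q ^+ 2) * qpoch_oo b (q ^+ 2)
    * qpoch_oo (b * (c * q) ^+ 2 * q) (q ^+ 2) * qpoch_oo (b' * (c * q) ^+ 2 * q) (q ^+ 2))
  * vwp_term (q ^+ 2) (q ^+ 2 * a) l (q ^+ 2) r).
Proof.
move=> nz a1 qa1 m1 m2 m3 m4; rewrite vwp_termE//.
have a0 : a != 0 by rewrite mulf_neq0.
have nzr d : d \in vwp_den (q ^+ 2) (q ^+ 2 * a) l -> qpoch d (q ^+ 2) r != 0.
  exact: nonzero_factors_qpoch.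
have w0 : w != 0 by rewrite /w !mulf_neq0 ?invr_neq0 ?mulf_neq0 ?expf_neq0.
have e1 : q ^+ 2 * a * q ^+ 2 / (b' * q) = b * (c * q) ^+ 2 * q.
  by rewrite /a -bbc; field; rewrite b'0 q0.
have e2 : q ^+ 2 * a * q ^+ 2 / (b * q) = b' * (c * q) ^+ 2 * q.
  by rewrite /a -bbc; field; rewrite b0 q0.
have e3 : q ^+ 2 * a * q ^+ 2 / (a * q) = q * q * q by field; rewrite a0 q0.
have e4 x : x != 0 -> q ^+ 2 * a * q ^+ 2 / (x * q) = a * q / x * q * q.
  by move=> x0; field; rewrite x0 q0.
have e5 x : x != 0 -> q ^+ 2 * a * q ^+ 2 / (x * q ^+ 2) = a * q / x * q.
  by move=> x0; field; rewrite x0 q0.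
have := (nzr (q ^+ 2), nzr (b * (c * q) ^+ 2 * q), nzr (b' * (c * q) ^+ 2 * q),
  nzr (q * q * q), nzr (a * q / y * q), nzr (a * q / y * q * q), nzr (a * q / z * q),
  nzr (a * q / z * q * q), nzr (a * q / w * q), nzr (a * q / w * q * q)).
rewrite /vwp_den /l /= e1 e2 e3 !e4// !e5// !inE !eqxx !orbT.
move=> [[[[[[[[[n1 n2] n3] n4] n5] n6] n7] n8] n9] n10].
have {}n1 := n1 isT; have {}n2 := n2 isT; have {}n3 := n3 isT; have {}n4 := n4 isT.
have {}n5 := n5 isT; have {}n6 := n6 isT; have {}n7 := n7 isT; have {}n8 := n8 isT.
have {}n9 := n9 isT; have {}n10 := n10 isT.
rewrite !qpochs_cons !qpochs_nil /alpha_summand /wp_alpha -/a -/w.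
rewrite !qpochSl !qpoch_dissect !qpoch_alt_odd.
have qr : q ^+ (r + r).+1 = q * (q ^+ 2) ^+ r by rewrite exprS addnn -mul2n exprM.
have -> : (- q) ^+ (r + r).+1 = - (q * (q ^+ 2) ^+ r).
  by rewrite exprS addnn -mul2n exprM sqrrN mulNr.
rewrite qr.
have qq2 : q * q = q ^+ 2 by rewrite expr2.
have aq2 : a * q * q = q ^+ 2 * a by ring.
have xq2 x : x * q ^+ 2 = x * q * q by ring.
rewrite aq2 !(xq2 y, xq2 z, xq2 w) qq2 in n4 *.
rewrite (qpoch_ooD _ (b * (c * q) ^+ 2 * q) r q21) (qpoch_ooD _ (b' * (c * q) ^+ 2 * q) r q21).
rewrite !(mulrA _ q ((q ^+ 2) ^+ r)).
move: (qpoch (q ^+ 2) _ r) n1 (qpoch (b * (c * q) ^+ 2 * q) _ r) n2 => P1 n1 P2 n2.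
move: (qpoch (b' * (c * q) ^+ 2 * q) _ r) n3 (qpoch (q ^+ 2 * q) _ r) n4 => P3 n3 P4 n4.
move: (qpoch (a * q / y * q) _ r) n5 (qpoch (a * q / y * q * q) _ r) n6 => P5 n5 P6 n6.
move: (qpoch (a * q / z * q) _ r) n7 (qpoch (a * q / z * q * q) _ r) n8 => P7 n7 P8 n8.
move: (qpoch (a * q / w * q) _ r) n9 (qpoch (a * q / w * q * q) _ r) n10 => P9 n9 P10 n10.
set Q1 := qpoch (a * q) _ _; set Q2 := qpoch (q ^+ 2 * a) _ _; set Q3 := qpoch (b * q) _ _.
set Q4 := qpoch (b' * q) _ _; set Q5 := qpoch (y * q) _ _; set Q6 := qpoch (y * q * q) _ _.
set Q7 := qpoch (z * q) _ _; set Q8 := qpoch (z * q * q) _ _; set Q9 := qpoch (w * q) _ _.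
set Q10 := qpoch (w * q * q) _ _; set O1 := qpoch_oo b _; set O2 := qpoch_oo b' _.
set O3 := qpoch_oo (b * (c * q) ^+ 2 * q * _) _.
set O4 := qpoch_oo (b' * (c * q) ^+ 2 * q * _) _.
move: m2 m3 m4; set qy := a * q / y; set qz := a * q / z; set qw := a * q / w => m2 m3 m4.
set x := (q ^+ 2) ^+ r.
clearbody Q1 Q2 Q3 Q4 Q5 Q6 Q7 Q8 Q9 Q10 O1 O2 O3 O4 qy qz qw x.
by field; rewrite n1 n2 n3 n4 n5 n6 n7 n8 n9 n10 qa1 m1 m2 m3 m4.
Qed.

End VeryWellPoisedSummands.

(** * The transformation formula *)

Lemma series_double {V : zmodType} (t : nat -> V) L :
  series t (L + L)%N = series (fun r => t (r + r)%N + t (r + r).+1) L.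
Proof.
elim: L => [|L IH]; first by rewrite /series /= !big_geq.
by rewrite addSn addnS !seriesSr IH addrA.
Qed.

Theorem corollary1 (R : realType) (q a b k y z : R[i])
  (* the parameters a4, ..., a_{r+1} of the three series, in order *)
  (s1 := [:: k ^+ 2 / (a * b); b; sqrtC (q * a); - sqrtC (q * a);
             k * y / a; k * z / a; a * q / (y * z)])
  (s2 := [:: k ^+ 2 / (a * b); b; a * q; y; y * q; z; z * q;
             a ^+ 2 * q / (k * y * z); a ^+ 2 * q ^+ 2 / (k * y * z)])
  (s3 := [:: k ^+ 2 * q / (a * b); b * q; a * q; y * q; y * q ^+ 2;
             z * q; z * q ^+ 2;
             a ^+ 2 * q ^+ 2 / (k * y * z); a ^+ 2 * q ^+ 3 / (k * y * z)])
  (hq0 : q != 0) (ha0 : a != 0) (hb0 : b != 0)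
  (hk0 : k != 0) (hy0 : y != 0) (hz0 : z != 0)
  (hq1 : `|q| < 1)
  (hden_prod : nonzero_factors [:: k * q; q * a / k] q)
  (hden_q : 1 - q != 0)
  (hden_y : 1 - a * q / y != 0)
  (hden_z : 1 - a * q / z != 0)
  (hden_kyz : 1 - k * y * z / a != 0)
  (hden1 : nonzero_factors (vwp_den q k s1) q)
  (hden2 : nonzero_factors (vwp_den (q ^+ 2) a s2) (q ^+ 2))
  (hden3 : nonzero_factors (vwp_den (q ^+ 2) (q ^+ 2 * a) s3) (q ^+ 2))
  (hcvg1 : vwp_abs_cvg q k s1 (- (q * a / k)))
  (hcvg2 : vwp_abs_cvg (q ^+ 2) a s2 (q ^+ 2))
  (hcvg3 : vwp_abs_cvg (q ^+ 2) (q ^+ 2 * a) s3 (q ^+ 2)) :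
  qpochs_oo [:: q * a * b / k; k * q / b] q
    * qpochs_oo [:: q; k ^+ 2 * q / a; q ^+ 2 * a; q ^+ 2 * a ^+ 2 / k ^+ 2]
        (q ^+ 2)
    / qpochs_oo [:: k * q; q * a / k] q
    * vwpW q k s1 (- (q * a / k))
  =
  qpochs_oo [:: k ^+ 2 * q / (a * b); b * q; a ^+ 2 * b * q ^+ 2 / k ^+ 2;
                q ^+ 2 * a / b] (q ^+ 2)
    * vwpW (q ^+ 2) a s2 (q ^+ 2)
  - q * ((1 - a * q ^+ 2) * (1 - y) * (1 - z) * (1 - a ^+ 2 * q / (k * y * z))
         / ((1 - q) * (1 - a * q / y) * (1 - a * q / z) * (1 - k * y * z / a)))
    * qpochs_oo [:: k ^+ 2 / (a * b); b; a ^+ 2 * b * q ^+ 3 / k ^+ 2;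
                    q ^+ 3 * a / b] (q ^+ 2)
    * vwpW (q ^+ 2) (q ^+ 2 * a) s3 (q ^+ 2).

Proof.
pose c := a / k; pose b' := k ^+ 2 / (a * b); pose w := c ^+ 2 * k * q / (y * z).
have q1 : normc q < 1 by rewrite -ltcR -normcE_real.
have aE : c * k = a by rewrite /c divfK.
have c0 : c != 0 by rewrite mulf_neq0 ?invr_eq0.
have b'0 : b' != 0 by rewrite mulf_neq0 ?invr_eq0 ?mulf_neq0 ?expf_neq0.
have bbc : b * b' * c = k by rewrite /b' /c; field; rewrite ha0 hb0 hk0.
have kE x : x != 0 -> k * x / a = x / c by move=> x0; rewrite /c; field; rewrite ha0 hk0.
have wE : a ^+ 2 * q / (k * y * z) = w.
  by rewrite /w /c; field; rewrite hk0 hy0 hz0.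
have awE : a * q / w = k * y * z / a.
  by rewrite /w /c; field; rewrite hk0 hy0 hz0 ha0 hq0.
have s1E : s1 = [:: b'; b; sqrtC (q * (c * k)); - sqrtC (q * (c * k)); y / c; z / c; w / c].
  rewrite /s1 aE !kE// (_ : a * q / (y * z) = w / c)//.
  by rewrite /w /c; field; rewrite hk0 hy0 hz0 ha0.
have wqE n : a ^+ 2 * q ^+ n.+1 / (k * y * z) = w * q ^+ n.
  by rewrite -wE (exprS q n); field; rewrite hk0 hy0 hz0.
have s2E : s2 = [:: b'; b; c * k * q; y; y * q; z; z * q; w; w * q].
  by rewrite /s2 aE wE (wqE 1%N).
have s3E : s3 = [:: b' * q; b * q; c * k * q; y * q; y * q ^+ 2; z * q; z * q ^+ 2;
    w * q; w * q ^+ 2].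
  rewrite /s3 aE (wqE 1%N) (wqE 2%N) (_ : k ^+ 2 * q / (a * b) = b' * q)//.
  by rewrite /b' mulrAC.
have neq1 (x p : R[i]) : 1 - sqrtC x * p ^+ 0 != 0 -> 1 - - sqrtC x * p ^+ 0 != 0 -> 1 - x != 0.
  rewrite expr0 !mulr1 => h1 h2; rewrite -(sqrtCK x).
  have -> : 1 - sqrtC x ^+ 2 = (1 - sqrtC x) * (1 - - sqrtC x) by ring.
  by rewrite mulf_neq0.
have k1 : 1 - k != 0.
  by apply: (neq1 _ q); apply: hden1; rewrite /vwp_den !inE eqxx ?orbT.
have a1 : 1 - a != 0.
  by apply: (neq1 _ (q ^+ 2)); apply: hden2; rewrite /vwp_den !inE eqxx ?orbT.
have qa1 : 1 - q ^+ 2 * a != 0.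
  by apply: (neq1 _ (q ^+ 2)); apply: hden3; rewrite /vwp_den !inE eqxx ?orbT.
have den1 x d : x \in s1 -> k * q / x = d -> forall j : nat, 1 - d * q ^+ j != 0.
  move=> xs <-; apply: hden1; rewrite /vwp_den 3!in_cons.
  by rewrite (map_f (fun e => k * q / e) xs) !orbT.
have w0 : w != 0 by rewrite /w !mulf_neq0 ?invr_neq0 ?mulf_neq0 ?expf_neq0.
have bN : forall j : nat, 1 - b * (c * q) * q ^+ j != 0.
  apply: (den1 b'); first by rewrite s1E !inE eqxx.
  by rewrite -bbc; field; rewrite ?b'0.
have b'N : forall j : nat, 1 - b' * (c * q) * q ^+ j != 0.
  apply: (den1 b); first by rewrite s1E !inE eqxx ?orbT.
  by rewrite -bbc; field; rewrite ?hb0.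
have divN x : x != 0 -> x / c \in s1 -> forall j : nat, 1 - c * k * q / x * q ^+ j != 0.
  move=> x0 xs; apply: (den1 (x / c)) => //.
  by field; rewrite x0 c0.
have yN : forall j : nat, 1 - c * k * q / y * q ^+ j != 0.
  by apply: divN => //; rewrite s1E !inE eqxx ?orbT.
have zN : forall j : nat, 1 - c * k * q / z * q ^+ j != 0.
  by apply: divN => //; rewrite s1E !inE eqxx ?orbT.
have wN : forall j : nat, 1 - c * k * q / w * q ^+ j != 0.
  by apply: divN => //; rewrite s1E !inE eqxx ?orbT.
have kqN : forall j : nat, 1 - k * q * q ^+ j != 0.
  by apply: hden_prod; rewrite !inE eqxx.
have cqE : q * a / k = c * q by rewrite /c -mulrA mulrC.
have cqN : forall j : nat, 1 - c * q * q ^+ j != 0.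
  by rewrite -cqE; apply: hden_prod; rewrite !inE eqxx orbT.
pose s := sqrtC (q * (c * k)).
have s0 : s != 0 by rewrite /s sqrtC_eq0 aE mulf_neq0.
(* The factors of [(k^2 q/a; q^2)_n] come from the parameters [s] and [- s]. *)
have alN : forall j : nat, 1 - b * b' * q * (q ^+ 2) ^+ j != 0.
  move=> j; have sqE : (k * q / s) ^+ 2 = b * b' * q.
    rewrite exprMn exprVn /s sqrtCK -bbc; field.
    by rewrite hq0 c0 hb0 b'0.
  have -> : 1 - b * b' * q * (q ^+ 2) ^+ j =
      (1 - k * q / s * q ^+ j) * (1 - - (k * q / s) * q ^+ j).
    by rewrite -sqE (exprAC q 2 j); ring.
  rewrite mulf_neq0//.
    by apply: (den1 s) => //; rewrite s1E !inE eqxx ?orbT.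
  by apply: (den1 (- s)); rewrite ?invrN ?mulrN// s1E !inE eqxx ?orbT.
have beta_eq : vwp_term q k s1 (- (q * a / k)) = beta_summand q k c y z b b'.
  apply/funext => n; rewrite -(vwp_term_beta q k c y z b b')//.
    by rewrite s1E mulrA cqE (mulrC c).
  by rewrite -s1E.
have even_eq := vwp_term_alpha_even q k c y z b b' q1 c0 hk0 hq0 hy0 hz0 hb0 b'0 bbc.
have odd_eq := vwp_term_alpha_odd q k c y z b b' q1 c0 hk0 hq0 hy0 hz0 hb0 b'0 bbc.
rewrite -/w aE in s2E s3E even_eq odd_eq.
have cvg_alpha := wp_bailey_transform q k c y z b b' q1 c0 hk0 hq0 hy0 hz0 bbc k1
  kqN cqN yN zN wN bN b'N alN.
rewrite -beta_eq in cvg_alpha.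
have {}cvg_alpha := cvg_alpha (abs_cvg_normc _ hcvg1).
pose W1 := vwpW q k s1 (- (q * a / k)).
pose W2 := vwpW (q ^+ 2) a s2 (q ^+ 2).
pose W3 := vwpW (q ^+ 2) (q ^+ 2 * a) s3 (q ^+ 2).
pose C2 := qpoch_oo (b' * q) (q ^+ 2) * qpoch_oo (b * q) (q ^+ 2)
  * qpoch_oo (b * (c * q) ^+ 2) (q ^+ 2) * qpoch_oo (b' * (c * q) ^+ 2) (q ^+ 2).
pose C3 := qpoch_oo b' (q ^+ 2) * qpoch_oo b (q ^+ 2)
  * qpoch_oo (b * (c * q) ^+ 2 * q) (q ^+ 2) * qpoch_oo (b' * (c * q) ^+ 2 * q) (q ^+ 2).
pose D3 := q * ((1 - a * q ^+ 2) * (1 - y) * (1 - z) * (1 - w)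
  / ((1 - q) * (1 - a * q / y) * (1 - a * q / z) * (1 - a * q / w))).
have cvg2 : series (vwp_term (q ^+ 2) a s2 (q ^+ 2)) @ \oo --> W2.
  exact: (dominated_series_cvg _ _ (fun n => lexx _) (abs_cvg_normc _ hcvg2)).
have cvg3 : series (vwp_term (q ^+ 2) (q ^+ 2 * a) s3 (q ^+ 2)) @ \oo --> W3.
  exact: (dominated_series_cvg _ _ (fun n => lexx _) (abs_cvg_normc _ hcvg3)).
have even_step r : alpha_summand q k c y z b b' (r + r) =
    (1 - a) * C2 * vwp_term (q ^+ 2) a s2 (q ^+ 2) r.
  by rewrite even_eq -?s2E.
have odd_step r : alpha_summand q k c y z b b' (r + r).+1 =
    - ((1 - a) * D3 * C3 * vwp_term (q ^+ 2) (q ^+ 2 * a) s3 (q ^+ 2) r).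
  by rewrite odd_eq -?s3E// awE.
(* Along the partial sums of even length the merged series is a combination of
   partial sums of the two series on the right. *)
have transform : transform_constant q k c b b' * W1 = (1 - a) * (C2 * W2 - D3 * C3 * W3).
  apply: (cvg_uniqueC (fun L => series (alpha_summand q k c y z b b') (L + L)%N)).
    move: cvg_alpha; apply: cvg_comp => A [N _ NA]; exists N => // n /= Nn.
    by apply: NA => /=; rewrite (leq_trans Nn)// leq_addr.
  have -> : (fun L => series (alpha_summand q k c y z b b') (L + L)%N) =
      (fun L => (1 - a) * (C2 * series (vwp_term (q ^+ 2) a s2 (q ^+ 2)) L
        - D3 * C3 * series (vwp_term (q ^+ 2) (q ^+ 2 * a) s3 (q ^+ 2)) L)).
    apply/funext => L; rewrite series_double.
    elim: L => [|L IH]; first by rewrite /series /= !big_geq//; ring.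
    rewrite !seriesSr IH even_step odd_step.
    move: (vwp_term _ _ _ _ _) (vwp_term _ _ _ _ _) (series _ _) (series _ _) => t2 t3 S2 S3.
    clearbody C2 C3 D3.
    by ring.
  apply: cvgMC; first exact: cvg_cst.
  by apply: cvgBC; apply: cvgMC; [exact: cvg_cst|exact: cvg2|exact: cvg_cst|exact: cvg3].
rewrite -/W1 -/W2 -/W3.
rewrite !qpochs_oo_cons2 !qpochs_oo_seq1 wE -awE.
have -> : q * a * b / k = b * (c * q) by rewrite /c; ring.
have -> : k * q / b = b' * (c * q) by rewrite -bbc; field.
have -> : k ^+ 2 * q / a = b * b' * q by rewrite /b'; field; rewrite ha0 hb0.
have -> : q ^+ 2 * a ^+ 2 / k ^+ 2 = (c * q) ^+ 2 by rewrite /c; field.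
have -> : k ^+ 2 * q / (a * b) = b' * q by rewrite /b'; field; rewrite ha0 hb0.
have -> : a ^+ 2 * b * q ^+ 2 / k ^+ 2 = b * (c * q) ^+ 2 by rewrite /c; field.
have -> : a ^+ 2 * b * q ^+ 3 / k ^+ 2 = b * (c * q) ^+ 2 * q by rewrite /c; field.
have -> : q ^+ 2 * a / b = b' * (c * q) ^+ 2.
  by rewrite /b' /c; field; rewrite ha0 hb0 hk0.
have -> : q ^+ 3 * a / b = b' * (c * q) ^+ 2 * q.
  by rewrite /b' /c; field; rewrite ha0 hb0 hk0.
rewrite cqE -/b' -/w (qpoch_oo_sqr q (c * q) q1) (mulrC (q ^+ 2) a).
have kq_oo : qpoch_oo (k * q) q != 0 by exact: qpoch_oo_neq0.
have cq_oo : qpoch_oo (c * q) q != 0 by exact: qpoch_oo_neq0.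
apply: (mulfI a1); move: transform.
rewrite /transform_constant aE (qpoch_oo_step (q ^+ 2) a (normc_sqr_lt1 _ q1)).
rewrite /C2 /C3 /D3 => transform.
transitivity ((1 - a) * (C2 * W2 - D3 * C3 * W3)).
  rewrite /C2 /C3 /D3 -transform.
  move: kq_oo cq_oo; set K1 := qpoch_oo (k * q) q; set K2 := qpoch_oo (c * q) q.
  set P1 := qpoch_oo (b * (c * q)) q; set P2 := qpoch_oo (b' * (c * q)) q.
  set P3 := qpoch_oo (- (c * q)) q; set P4 := qpoch_oo (a * q ^+ 2) _.
  set P5 := qpoch_oo (b * b' * q) _; set P6 := qpoch_oo q _ => n1 n2.
  move: {transform} W1 => W; clearbody K1 K2 P1 P2 P3 P4 P5 P6.
  by field; rewrite n1 n2.
clear transform; clearbody W2 W3; rewrite /C2 /C3 -/D3; clearbody D3.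
set X1 := qpoch_oo (b' * q) _; set X2 := qpoch_oo (b * q) _.
set X3 := qpoch_oo (b * (c * q) ^+ 2) _; set X4 := qpoch_oo (b' * (c * q) ^+ 2) _.
set X5 := qpoch_oo b' _; set X6 := qpoch_oo b _.
set X7 := qpoch_oo (b * (c * q) ^+ 2 * q) _; set X8 := qpoch_oo (b' * (c * q) ^+ 2 * q) _.
clearbody X1 X2 X3 X4 X5 X6 X7 X8.
by ring.
Qed.
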